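(* Let $\varepsilon>0$. Let $F(\mathbf{x})\in\overline{\mathbb{Q}}[x_1,x_2,x_3]$ be a form of degree $d$ which is irreducible over $\overline{\mathbb{Q}}$, and let $B_1,B_2,B_3\geq 1$. Then $$N(F;B_1,B_2,B_3)\ll_{d,\varepsilon} T^{-d^{-2}}\,V^{d^{-1}+\varepsilon};$$ in particular, for all $B\geq 1$, $N(F;B)\ll_{d,\varepsilon} B^{2/d+\varepsilon}$; and if moreover $F$ is nonsingular, then $N(F;B_1,B_2,B_3)\ll_{d,\varepsilon} V^{2/(3d)+\varepsilon}$. All implied constants depend only on $d$ and $\varepsilon$. Indeed, if $F$ is not a constant multiple (by an element of $\overline{\mathbb{Q}}$) of a form with rational coefficients, then $N(F;B)\leq d^2$ for all $B\geq 1$.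
   Context: $Z_3$ denotes the set of all nonzero $\mathbf{x}=(x_1,x_2,x_3)\in\mathbb{Z}^3$ with $\gcd(x_1,x_2,x_3)=1$ and such that $x_i>0$ for the smallest index $i$ with $x_i\neq 0$. For $B_1,B_2,B_3\geq 1$, $$N(F;B_1,B_2,B_3)=\#\{\mathbf{x}\in Z_3:\ F(\mathbf{x})=0,\ |x_i|\leq B_i\ (1\leq i\leq 3)\},$$ and $N(F;B)=N(F;B,B,B)$. Put $V=B_1B_2B_3$ and $$T=\max\{B_1^{f_1}B_2^{f_2}B_3^{f_3}\},$$ the maximum being over all integer triples $(f_1,f_2,f_3)$ such that the monomial $x_1^{f_1}x_2^{f_2}x_3^{f_3}$ occurs in $F$ with nonzero coefficient. ''Nonsingular'' means that $\nabla F(\mathbf{x})\neq\mathbf{0}$ for every nonzero $\mathbf{x}\in\overline{\mathbb{Q}}^3$ with $F(\mathbf{x})=0$.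
   Formalization: The bound V^{2/(3d)+ε} for nonsingular F is stated only for d≥2; for d=1 it is false (F=x_1 with box (1,B,B) has N of order B^2 but V^{2/3+ε}=B^{4/3+2ε}). *)

(* Defs.v *)
From mathcomp Require Import all_boot all_order all_algebra all_field.
From mathcomp Require Import finmap mpoly.
From mathcomp Require Import classical_sets cardinality reals exp.

Set Implicit Arguments.
Unset Strict Implicit.
Unset Printing Implicit Defensive.

Import Order.TTheory GRing.Theory Num.Theory.

Local Open Scope ring_scope.

(* The field of algebraic numbers is [algC] throughout. *)

Definition mirreducible (n : nat) (K : fieldType) (F : {mpoly K[n]}) : Prop :=
  [/\ F != 0, F \isn't a GRing.unit &
      forall G H : {mpoly K[n]}, F = G * H ->
        G \is a GRing.unit \/ H \is a GRing.unit].

Definition nonsingular (F : {mpoly algC[3]}) : Prop :=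
  forall x : 'I_3 -> algC, (exists i, x i != 0) -> F.@[x] = 0 ->
    exists i, (F^`M(i)).@[x] != 0.

Definition multiple_of_rational_form (F : {mpoly algC[3]}) : Prop :=
  exists (c : algC) (k : nat) (G : {mpoly rat[3]}),
    G \is k.-homog /\ F = c *: map_mpoly (ratr : rat -> algC) G.

Definition Z3 (x : {ffun 'I_3 -> int}) : Prop :=
  [/\ x != 0, \big[gcdz/0]_(i < 3) x i = 1 &
      forall i, x i != 0 -> (forall j : 'I_3, (j < i)%N -> x j = 0) -> 0 < x i].

Section Counting.

Variable R : realType.
Implicit Types (F : {mpoly algC[3]}) (B : 'I_3 -> R).

Definition points F B : set {ffun 'I_3 -> int} :=
  [set x | [/\ Z3 x, F.@[fun i => (x i)%:~R] = 0 &
               forall i, `|(x i)%:~R : R| <= B i]]%classic.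

Lemma finite_points F B : finite_set (points F B).
Proof.
pose M := (\max_(i < 3) Num.truncn (B i))%N.
pose g (f : {ffun 'I_3 -> 'I_(M + M).+1}) : {ffun 'I_3 -> int} :=
  [ffun i => (f i : nat)%:Z - M%:Z].
apply: (@sub_finite_set _ _ (g @` setT)%classic); last first.
  exact/finite_image/finite_finset.
move=> x [_ _ xB].
have xM i : `|x i| <= M%:Z.
  rewrite -abszE lez_nat; apply: leq_trans (leq_bigmax i).
  have B0 : 0 <= B i by exact: le_trans (xB i).
  by rewrite truncn_ge_nat // natr_absz intr_norm.
exists [ffun i => inord (absz (x i + M%:Z))] => //.
apply/ffunP => i; rewrite !ffunE.
have := xM i; rewrite ler_norml => /andP[lo hi].
have p0 : 0 <= x i + M%:Z by rewrite -lerBlDr sub0r.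
rewrite inordK ?gez0_abs ?addrK //.
by rewrite ltnS -lez_nat gez0_abs // PoszD lerD2r.
Qed.

(* [fset_set] is only meaningful on finite sets; see [finite_points]. *)
Definition npoints F B : nat := #|` fset_set (points F B)|%fset.

Definition boxV B : R := \prod_(i < 3) B i.

(* For [B i >= 1] every monomial value is positive, so the default [0] of the
   iterated maximum plays no role when [F != 0]. *)
Definition boxT F B : R :=
  \big[Num.max/0]_(m <- msupp F) \prod_(i < 3) B i ^+ m i.

End Counting.

(* Main.v *)
(** Heath-Brown's determinant method, with Siegel's lemma in place of the determinant.

    Two coprime forms of degrees d and e have at most d e common zeros: comparing Hilbert
    functions in a large degree, the ideal they generate has codimension d e, while N
    distinct points impose N independent conditions.  Coprimality to an irreducible F
    amounts to not being a multiple of F because polynomial rings are factorial.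

    As F vanishes at the counted points, these impose dependent conditions on forms of
    degree d, and Siegel's lemma gives an integral form G of degree d vanishing at all of
    them with coefficients bounded by a power of V.  Either G is not a multiple of F and Bezout gives
    at most d^2 points, or F is proportional to G, hence rational, and may be replaced by G.

    Fix a prime p and a nonsingular point of the curve modulo p.  By Hensel's lemma the
    points of the curve in this residue class satisfy x = c y(t) modulo p^s for fixed
    integral polynomials y, with p dividing t.  A form A vanishes modulo p^s on the class as
    soon as the coefficient of t^l in A(y(t)) is divisible by p^(s - l) for l < s, and
    Siegel's lemma provides such an A with so small coefficients that A vanishes on the
    class.  The monomials of A are those of degree d + n which are not divisible by a
    monomial x^m of F of maximal weight T on the box; this keeps A from being a multiple of
    F, and it produces the factor T^(-1/d^2): with s monomials the condition is roughly
    p^(s(s-1)/2) > prod_e B^e, that is p > V^(1/d + eta) T^(-1/d^2).  There are at most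
    9 p d classes, and each of them contains at most d (d + n) points.  A bounded number of
    primes p of this size suffices, as their product exceeds every nonzero value of a
    partial derivative of F in the box.

    A nonsingular form of degree at least 2 satisfies T^3 >= V^d by semistability. *)

From HB Require Import structures.
Require Import Defs.
From mathcomp Require Import all_boot all_order all_algebra all_field.
From mathcomp Require Import finmap mpoly.
From mathcomp Require Import classical_sets cardinality boolp reals exp.
From mathcomp Require Import ring lra zify.

Set Implicit Arguments.
Unset Strict Implicit.
Unset Printing Implicit Defensive.

Import Order.TTheory GRing.Theory Num.Theory.
Local Open Scope ring_scope.

(** * Factoriality of multivariate polynomial rings *)

Definition rdvd (R : comNzRingType) (a b : R) := exists c, b = c * a.

Definition prime_elt (R : idomainType) (p : R) :=
  [/\ p != 0, p \isn't a GRing.unit &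
      forall a b, rdvd p (a * b) -> rdvd p a \/ rdvd p b].

(** The index counts the prime factors and is the termination measure of [primitive_part]. *)
Inductive factored (R : idomainType) : nat -> R -> Prop :=
| FactoredUnit u of u \is a GRing.unit : factored 0 u
| FactoredPrime n p a of prime_elt p & factored n a : factored n.+1 (p * a).

Definition ufd (R : idomainType) :=
  forall a : R, a != 0 -> exists n, factored n a.

Lemma factored_mulu (R : idomainType) n (a u : R) :
  u \is a GRing.unit -> factored n a -> factored n (u * a).
Proof.
move=> uu; elim=> [v uv|m p b pp _ IH]; first by constructor; rewrite unitrM uu.
by rewrite mulrCA; constructor.
Qed.

Lemma factored_mul (R : idomainType) n m (a b : R) :
  factored n a -> factored m b -> factored (n + m) (a * b).
Proof.
elim=> [u uu|k p c pp _ IH] fb; first exact: factored_mulu.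
by rewrite -mulrA addSn; constructor => //; apply: IH.
Qed.

Lemma prime_rdvd_unit (R : idomainType) (p u : R) :
  prime_elt p -> u \is a GRing.unit -> ~ rdvd p u.
Proof.
case=> _ pu _ uu [c ucp]; case/negP: pu.
by move: uu; rewrite ucp unitrM => /andP[].
Qed.

Lemma factored_divp (R : idomainType) n (a q b : R) :
  prime_elt q -> factored n a -> a = q * b -> exists2 m, n = m.+1 & factored m b.
Proof.
move=> pq fa; elim: fa b => {n a} [u uu|n p a pp fa IH] b def.
  by case: (prime_rdvd_unit pq uu); exists b; rewrite mulrC.
exists n => //; have [q0 qu qP] := pq.
have [[c pc]|[c ac]] : rdvd q p \/ rdvd q a by apply: qP; exists b; rewrite def mulrC.
  have cu : c \is a GRing.unit.
    have [p0 pu pP] := pp.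
    have [[e cE]|[e qE]] : rdvd p c \/ rdvd p q by apply: pP; exists 1; rewrite mul1r.
      case/negP: qu; apply/unitrP; exists e; rewrite mulrC; split=> //;
      by apply: (mulIf p0); rewrite mul1r {2}pc cE -mulrA [p * q]mulrC mulrA // [q * e]mulrC.
    rewrite qE in pc; apply/unitrP; exists e; split.
      by apply: (mulIf p0); rewrite mul1r {2}pc mulrA [e * c]mulrC.
    by apply: (mulIf p0); rewrite mul1r {2}pc mulrA.
  have -> : b = c * a by apply: (mulfI q0); rewrite -def pc mulrCA mulrA.
  exact: factored_mulu.
have [m -> fc] := IH c (etrans ac (mulrC _ _)).
have -> : b = p * c by apply: (mulfI q0); rewrite -def ac; ring.
by constructor.
Qed.

Lemma ufd_irreducible_prime (R : idomainType) (a : R) : ufd R ->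
  a != 0 -> a \isn't a GRing.unit ->
  (forall b c, a = b * c -> b \is a GRing.unit \/ c \is a GRing.unit) ->
  prime_elt a.
Proof.
move=> ufdR a0 au airr; have [n fa] := ufdR a a0.
case: fa a0 au airr => [u ->//|m p b pp fb a0 au airr].
have [p0 pu pP] := pp.
have bu : b \is a GRing.unit by case: (airr p b erefl) => //; rewrite (negbTE pu).
split=> // x y [c xy].
have dvd z : rdvd p z -> rdvd (p * b) z.
  by move=> [e ->]; exists (e * b^-1); rewrite [p * b]mulrC mulrA divrK.
case: (pP x y); first by exists (c * b); rewrite xy -mulrA [b * p]mulrC.
  by left; apply: dvd.
by right; apply: dvd.
Qed.

Section Poly.
Variable R : idomainType.
Hypothesis ufdR : ufd R.

Lemma rdvd_polyC_lead (p : R) (f : {poly R}) :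
  rdvd p%:P f -> rdvd p (lead_coef f).
Proof. by case=> g ->; exists (lead_coef g); rewrite lead_coefM lead_coefC. Qed.

Lemma prime_polyC (p : R) : prime_elt p -> prime_elt p%:P.
Proof.
move=> pp; have [p0 pu pP] := pp; split; first by rewrite polyC_eq0.
  by rewrite poly_unitE size_polyC p0 coefC.
move=> f g; have [n] := ubnP (size f + size g).
elim: n f g => // n IH f g lefg dfg.
have [->|f0] := eqVneq f 0; first by left; exists 0; rewrite mul0r.
have [->|g0] := eqVneq g 0; first by right; exists 0; rewrite mul0r.
have sub (h : {poly R}) : h != 0 -> rdvd p (lead_coef h) ->
    exists2 h' : {poly R}, (size h' < size h)%N & exists k, h = h' + k * p%:P.
  move=> h0 [c lh]; exists (h - lead_coef h *: 'X^((size h).-1)); last first.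
    exists (c *: 'X^((size h).-1)); rewrite mulrC mul_polyC scalerA [p * c]mulrC -lh.
    by rewrite subrK.
  have sh : (size h).-1.+1 = size h by rewrite prednK // lt0n size_poly_eq0.
  rewrite -[X in (_ < X)%N]sh ltnS; apply/leq_sizeP => j lej.
  rewrite coefB coefZ coefXn; have [->|nj] := eqVneq j (size h).-1.
    by rewrite mulr1 subrr.
  rewrite mulr0 subr0 nth_default // -sh ltn_neqAle eq_sym nj //.
have := rdvd_polyC_lead dfg; rewrite lead_coefM => /pP [/(sub _ f0)|/(sub _ g0)].
  case=> f' ltf [k fE]; case: (IH f' g).
  - by move: lefg; rewrite ltnS; apply: leq_trans; rewrite ltn_add2r.
  - case: dfg => c dfg; exists (c - k * g).
    by rewrite mulrBl -dfg fE mulrDl mulrAC addrK.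
  - by case=> e f'E; left; exists (e + k); rewrite fE f'E mulrDl.
  - by right.
case=> g' ltg [k gE]; case: (IH f g').
- by move: lefg; rewrite ltnS; apply: leq_trans; rewrite ltn_add2l.
- case: dfg => c dfg; exists (c - k * f).
  by rewrite mulrBl -dfg gE mulrDr mulrA [f * k]mulrC addrK.
- by left.
- by case=> e g'E; right; exists (e + k); rewrite gE g'E mulrDl.
Qed.

Lemma factored_polyC n (c : R) : factored n c -> factored n c%:P.
Proof.
elim=> [u uu|m p a pp _ IH].
  by constructor; rewrite poly_unitE size_polyC coefC /= uu (memPn _ _ uu) // unitr0.
by rewrite polyCM; constructor => //; apply: prime_polyC.
Qed.

Definition primitive (f : {poly R}) := forall p, prime_elt p -> ~ rdvd p%:P f.

Lemma primitive_cancel n (c : R) (f h w : {poly R}) :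
  factored n c -> primitive f -> c%:P * h = w * f -> rdvd f h.
Proof.
move=> fc pf; elim: fc w => {n c} [u uu|n p a pp _ IH] w eq.
  exists (u^-1%:P * w); rewrite -mulrA -eq mulrA -polyCM mulVr //.
  by rewrite mul1r.
have [_ _ pP] := prime_polyC pp.
have [[w' wE]|] : rdvd p%:P w \/ rdvd p%:P f; last by move/pf.
  by apply: pP; exists (a%:P * h); rewrite -eq polyCM; ring.
apply: (IH w'); have p0 : p%:P != 0 :> {poly R} by rewrite polyC_eq0; case: pp.
by apply: (mulfI p0); rewrite mulrA -polyCM eq wE; ring.
Qed.

Lemma factor_cancel n (c : R) (f d e : {poly R}) : factored n c -> c%:P * f = d * e ->
  exists d' e', [/\ f = d' * e', size d' = size d & size e' = size e].
Proof.
move=> fc; elim: fc d e => {n c} [u uu|n p a pp _ IH] d e eq.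
  exists (u^-1%:P * d), e; split=> //; last first.
    by rewrite mul_polyC size_scale // invr_eq0 (memPn _ _ uu) // unitr0.
  by rewrite -mulrA -eq mulrA -polyCM mulVr // mul1r.
have [p0 _ pP] := prime_polyC pp.
have sz (k : {poly R}) : size (k * p%:P) = size k.
  by rewrite mulrC mul_polyC size_scale //; case: pp.
have [[k dE]|[k eE]] : rdvd p%:P d \/ rdvd p%:P e.
- by apply: pP; exists (a%:P * f); rewrite -eq polyCM; ring.
- have [|d' [e' [-> sd se]]] := IH k e.
    by apply: (mulfI p0); rewrite mulrA -polyCM eq dE; ring.
  by exists d', e'; split=> //; rewrite dE sz.
have [|d' [e' [-> sd se]]] := IH d k.
  by apply: (mulfI p0); rewrite mulrA -polyCM eq eE; ring.
by exists d', e'; split=> //; rewrite eE sz.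
Qed.

Lemma primitive_part (f : {poly R}) : f != 0 ->
  exists n c g, [/\ factored n c, f = c%:P * g & primitive g].
Proof.
move=> f0; have [|n fl] := ufdR (a := lead_coef f); first by rewrite lead_coef_eq0.
elim: n f f0 fl => [|n IH] f f0 fl; have [pf|npf] := EM (primitive f).
- by exists 0%N, 1, f; split; rewrite ?mul1r //; constructor; rewrite unitr1.
- case: npf => p pp /rdvd_polyC_lead [b lE].
  by have [] := factored_divp (b := b) pp fl _; rewrite // lE mulrC.
- by exists 0%N, 1, f; split; rewrite ?mul1r //; constructor; rewrite unitr1.
have [p [pp [g fE]]] : exists p, prime_elt p /\ rdvd p%:P f.
  by apply: contrapT => H; apply: npf => p pp dp; apply: H; exists p.
have [|m [Em] fg] := factored_divp (b := lead_coef g) pp fl.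
  by rewrite fE lead_coefM lead_coefC mulrC.
rewrite -Em in fg; have g0 : g != 0 by apply: contraNneq f0 => g0; rewrite fE g0 mul0r.
have [k [c [h [fc gE ph]]]] := IH g g0 fg.
exists k.+1, (p * c), h; split=> //; first by constructor.
by rewrite fE gE polyCM mulrC mulrA.
Qed.

Lemma primitive_prime (f : {poly R}) : (1 < size f)%N -> primitive f ->
  (forall d e, f = d * e -> (1 < size d < size f)%N -> False) -> prime_elt f.
Proof.
move=> sf pf nof.
have f0 : f != 0 by rewrite -size_poly_gt0 (leq_trans _ sf).
split=> // [|g h [k ghE]].
  by rewrite poly_unitE; move: sf; case: eqP => // ->.
have [->|g0] := eqVneq g 0; first by left; exists 0; rewrite mul0r.
have [sg|sg] := leqP (size g) 1.
  have gE := size1_polyC sg.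
  have [|n fc] := ufdR (a := g`_0); first by rewrite -polyC_eq0 -gE.
  by right; apply: (primitive_cancel fc pf (w := k)); rewrite -gE.
(* A nonzero resultant is a constant in the ideal (f, g); otherwise f, having no proper
   factor of positive degree, divides g up to constants. *)
have [r0|r0] := eqVneq (resultant f g) 0; last first.
  have [n fc] := ufdR r0.
  have [[u v] /= _ rE] := resultant_in_ideal sf sg.
  right; apply: (primitive_cancel fc pf (w := u * h + v * k)).
  by rewrite rE mulrDl -[v * g * h]mulrA ghE; ring.
left; move/eqP: r0; rewrite resultant_eq0 => sgcd.
have /Pdiv.Idomain.dvdpP[[c e] /= c0 fE] := Pdiv.Idomain.dvdp_gcdl f g.
have /Pdiv.Idomain.dvdpP[[c2 m] /= c20 gE] := Pdiv.Idomain.dvdp_gcdr f g.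
set d := gcdp f g in sgcd fE gE.
have [n fc] := ufdR c0; have [n2 fc2] := ufdR c20.
rewrite -!mul_polyC in fE gE.
have [e' [d' [fE' se sd]]] := factor_cancel fc fE.
have e'0 : e' != 0 by apply: contraNneq f0 => z; rewrite fE' z mul0r.
have d'0 : d' != 0 by apply: contraNneq f0 => z; rewrite fE' z mulr0.
have se1 : size e = 1%N.
  apply/eqP; rewrite -se eqn_leq lt0n size_poly_eq0 e'0 andbT leqNgt; apply/negP => se1.
  apply: (nof d' e'); first by rewrite mulrC.
  rewrite sd sgcd -sd fE' size_mul //.
  by move: se1 sgcd; rewrite -sd; lia.
have eE := size1_polyC (eq_leq se1).
have e0 : e`_0 != 0 by rewrite -polyC_eq0 -eE -size_poly_eq0 se1.
have [n3 fc3] := ufdR (mulf_neq0 c20 e0).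
apply: (primitive_cancel fc3 pf (w := m * c%:P)).
rewrite polyCM -eE -[m * _ * f]mulrA fE.
by rewrite [_ * e]mulrC -mulrA gE; ring.
Qed.

Lemma ufd_poly : ufd {poly R}.
Proof.
move=> f; have [n] := ubnP (size f).
elim: n f => // n IH f ltfn f0.
have [k [c [g [fc fE pg]]]] := primitive_part f0.
suff [m fg] : exists m, factored m g.
  by exists (k + m)%N; rewrite fE; apply: factored_mul => //; apply: factored_polyC.
have g0 : g != 0 by apply: contraNneq f0 => z; rewrite fE z mulr0.
have c0 : c != 0 by apply: contraNneq f0 => z; rewrite fE z mul0r.
have sfg : size f = size g by rewrite fE mul_polyC size_scale.
have [sg|sg] := leqP (size g) 1.
  have [|m fg] := ufdR (a := g`_0); first by rewrite -polyC_eq0 -(size1_polyC sg).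
  by exists m; rewrite (size1_polyC sg); apply: factored_polyC.
have [[d [e [gE /andP[sd sdg]]]]|H] :=
  EM (exists d e, g = d * e /\ (1 < size d < size g)%N); last first.
  exists 1%N; rewrite -[g]mulr1; constructor; last by constructor; rewrite unitr1.
  by apply: primitive_prime => // d e gE sd; apply: H; exists d, e.
have d0 : d != 0 by apply: contraNneq g0 => z; rewrite gE z mul0r.
have e0 : e != 0 by apply: contraNneq g0 => z; rewrite gE z mulr0.
have [|//|m fd] := IH d; first by rewrite sfg in ltfn; apply: leq_trans sdg _; rewrite -ltnS.
have [|//|l fe] := IH e; last by exists (m + l)%N; rewrite gE; apply: factored_mul.
rewrite sfg in ltfn; rewrite ltnS in ltfn; apply: leq_trans ltfn.
by rewrite gE size_mul //; lia.
Qed.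

End Poly.

Lemma factored_reflect (R S : idomainType) (f : {rmorphism R -> S}) n b :
  injective f -> (forall c, exists a, c = f a) ->
  factored n b -> forall a, b = f a -> factored n a.
Proof.
move=> injf surf.
have unitf a : f a \is a GRing.unit -> a \is a GRing.unit.
  move=> /unitrP[v [v1 v2]]; have [c cE] := surf v.
  apply/unitrP; exists c; split; apply: injf; by rewrite rmorphM rmorph1 -cE.
have dvdf a c : rdvd (f a) (f c) -> rdvd a c.
  by move=> [e]; have [d ->] := surf e; rewrite -rmorphM => /injf ->; exists d.
elim=> [u uu a uE|m p c pp fc IH a pc]; first by constructor; apply: unitf; rewrite -uE.
have [p' pE] := surf p; have [c' cE] := surf c.
have -> : a = p' * c' by apply: injf; rewrite -pc pE cE rmorphM.
constructor; last exact: IH.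
have [p0 pu pP] := pp; split.
- by apply: contraNneq p0 => z; rewrite pE z rmorph0.
- by apply: contraNN pu; rewrite pE; apply: rmorph_unit.
move=> x y [d xy]; have := pP (f x) (f y); case.
- by exists (f d); rewrite pE -!rmorphM xy.
- by rewrite pE => /dvdf; left.
- by rewrite pE => /dvdf; right.
Qed.

Lemma ufd_reflect (R S : idomainType) (f : {rmorphism R -> S}) :
  injective f -> (forall b, exists a, b = f a) -> ufd S -> ufd R.
Proof.
move=> injf surf ufdS a a0; have [|n fa] := ufdS (f a).
  by rewrite -(rmorph0 f) (inj_eq injf).
by exists n; apply: (factored_reflect injf surf fa).
Qed.

Lemma ufd_field (K : fieldType) : ufd K.
Proof. by move=> a a0; exists 0%N; constructor; rewrite unitfE. Qed.

Section Muni.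
Variables (R : idomainType) (n : nat).

Let muniX m : muni ('X_[m] : {mpoly R[n.+1]}) =
  ('X_[[multinom m (widen_ord (leqnSn n) i) | i < n]])%:P * 'X^(m ord_max).
Proof. by rewrite muniE msuppX big_seq1 mcoeffX eqxx scale1r mul_polyC. Qed.

Lemma mmultiK : cancel (@mmulti n R) (@muni n R).
Proof.
move=> p; rewrite /mmulti rmorph_sum /= -[RHS]coefK poly_def.
apply: eq_bigr => i _; rewrite rmorphM rmorphXn /= -mul_polyC.
have -> : muni ('X_ord_max : {mpoly R[n.+1]}) = 'X.
  rewrite muniX mnmE eqxx expr1 (_ : [multinom _ | _ < n] = 0%MM) ?mpolyX0 ?mul1r //.
  apply/mnmP=> j; rewrite !mnmE; case: eqP => // /(congr1 val) /= jn.
  by have := ltn_ord j; rewrite -jn ltnn.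
congr (_ * _); elim/mpolyind: p`_i => [|c m q _ _ IH]; first by rewrite mwiden0 muni0.
rewrite mwidenD muniD IH polyCD; congr (_ + _).
rewrite mwidenZ mwidenX muniZ muniX mnmwiden_ordmax expr0 mulr1 -mul_polyC -polyCM mul_mpolyC.
by congr (_ *: 'X_[_])%:P; apply/mnmP => j; rewrite mnmE mnmwiden_widen.
Qed.

Lemma muni_inj : injective (@muni n R).
Proof.
move=> p q /eqP; rewrite -subr_eq0 -muniB => /eqP pq0.
apply/eqP; rewrite -subr_eq0; apply/eqP/mpolyP => m; rewrite mcoeff0.
set r := p - q in pq0 *; move: pq0.
move/polyP/(_ (m ord_max))/mpolyP/(_ [multinom m (widen_ord (leqnSn n) i) | i < n]).
rewrite coef0 mcoeff0 muniE coef_sum raddf_sum /=.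
under eq_bigr => k _ do rewrite coefZ coefXn.
have [|/memN_msupp_eq0 //] := boolP (m \in msupp r) => mr.
rewrite (bigD1_seq m) ?msupp_uniq //= eqxx mulr1 mcoeffZ mcoeffX eqxx mulr1.
rewrite big1 ?addr0 // => k km; case: eqP => [eo|]; last by rewrite mulr0 mcoeff0.
rewrite mulr1 mcoeffZ mcoeffX; case: eqP => [em|]; last by rewrite mulr0.
case/eqP: km; apply/mnmP => j; have [jn|jn] := eqVneq j ord_max; first by rewrite jn.
have ltj : (j < n)%N by rewrite ltn_neqAle -ltnS ltn_ord andbT.
have -> : j = widen_ord (leqnSn n) (Ordinal ltj) by apply: val_inj.
by move/mnmP/(_ (Ordinal ltj)): em; rewrite !mnmE.
Qed.

End Muni.

Lemma ufd_mpoly (R : idomainType) (n : nat) : ufd R -> ufd {mpoly R[n]}.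
Proof.
move=> ufdR; elim: n => [|n IH].
  apply: (ufd_reflect (f := mcoeff 0%MM)) ufdR.
    by move=> p q pq; rewrite [p]nvar0_mpolyC [q]nvar0_mpolyC; congr (_%:MP).
  by move=> c; exists c%:MP; rewrite /= mpolyCK.
apply: (ufd_reflect (f := @muni n R)) (ufd_poly IH); first exact: muni_inj.
by move=> p; exists (mmulti p); rewrite /= mmultiK.
Qed.

(** * Plane curves over a field and a Bezout bound *)

Section Bezout.

Lemma homog_mul (n : nat) (R : nzRingType) (d e m : nat) (p q : {mpoly R[n]}) :
  p \is d.-homog -> q \is e.-homog -> (d + e = m)%N -> p * q \is m.-homog.
Proof. by move=> hp hq <-; apply: dhomogM. Qed.

Lemma homog_prod (n : nat) (R : nzRingType) (I : Type) (s : seq I) (P : I -> {mpoly R[n]}) :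
  (forall i, P i \is 1.-homog) -> \prod_(i <- s) P i \is (size s).-homog.
Proof.
move=> hP; elim: s => [|i s IH]; first by rewrite big_nil dhomog1.
by rewrite big_cons; apply: homog_mul (hP i) IH _.
Qed.

Lemma pihomogMl (n : nat) (R : comNzRingType) (d k : nat) (p q : {mpoly R[n]}) :
  p \is d.-homog -> pihomog mdeg (d + k) (p * q) = p * pihomog mdeg k q.
Proof.
move=> hp; elim/mpolyind: q => [|c m q _ _ IH]; first by rewrite mulr0 !pihomog0 mulr0.
rewrite mulrDr !pihomogD IH mulrDr; congr (_ + _).
rewrite -scalerAr !linearZ /= -scalerAr; congr (_ *: _).
have hpm : p * 'X_[m] \is (d + mdeg m).-homog by apply: homog_mul hp _ _; rewrite ?dhomogX.
rewrite pihomogX; case: eqP => [<-|/eqP mk]; first by rewrite pihomog_dE.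
by rewrite mulr0 (pihomog_ne0 _ hpm) // eqn_add2l.
Qed.

Lemma homog_quotient (n : nat) (R : idomainType) (d k : nat) (p q : {mpoly R[n]}) :
  p != 0 -> p \is d.-homog -> p * q \is (d + k).-homog -> q \is k.-homog.
Proof.
move=> p0 hp hpq; rewrite homog_piE; apply/eqP/(mulfI p0).
by rewrite -(pihomogMl _ _ hp) pihomog_dE.
Qed.

Variable K : fieldType.
Implicit Types F G : {mpoly K[3]}.

Definition proj_distinct (x y : 'I_3 -> K) := exists a b, x a * y b != x b * y a.

Lemma separating_form N (x : 'I_N -> 'I_3 -> K) (k : nat) (i : 'I_N) :
  (forall i, exists a, x i a != 0) ->
  (forall i j, i != j -> proj_distinct (x i) (x j)) ->
  exists2 p : {mpoly K[3]}, p \is (N + k).-homog &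
    forall j, (p.@[x j] == 0) = (j != i).
Proof.
move=> x0 xd; have [a xa] := x0 i.
have lin j : exists l : {mpoly K[3]}, [/\ l \is 1.-homog,
    l.@[x i] != 0 & j != i -> l.@[x j] = 0].
  have [->|ji] := eqVneq j i.
    by exists 'X_a; rewrite dhomogX /= mdeg1 mevalXU; split.
  have [b [c bc]] : proj_distinct (x i) (x j) by apply: xd; rewrite eq_sym.
  exists (x j c *: 'X_b - x j b *: 'X_c); split.
  - by rewrite rpredB ?rpredZ // dhomogX /= mdeg1.
  - by rewrite mevalB !mevalZ !mevalXU mulrC [x j b * _]mulrC subr_eq0.
  by move=> _; rewrite mevalB !mevalZ !mevalXU mulrC subrr.
have [l lP] := choice lin.
exists ((\prod_(j <- enum 'I_N) l j) * 'X_a ^+ k).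
  apply: (homog_mul (d := N) (e := k)) => //.
    by rewrite -[N in N.-homog](size_enum_ord N); apply: homog_prod => j; case: (lP j).
  by rewrite -[k in k.-homog]mul1n; apply: dhomogMn; rewrite dhomogX /= mdeg1.
move=> j; rewrite mevalM rmorphXn /= mevalXU rmorph_prod /=.
rewrite big_enum /=; have [->|ji] := eqVneq j i.
  apply/negbTE; rewrite mulf_neq0 ?expf_neq0 //.
  by apply/prodf_neq0 => m _; case: (lP m).
by rewrite (bigD1 j) //= (_ : (l j).@[x j] = 0) ?mul0r ?eqxx //; case: (lP j) => _ _ /(_ ji).
Qed.

Lemma mulhomog_lfun d e n F : F \is d.-homog -> F != 0 -> (d + e = n)%N ->
  exists f : 'Hom(dhomog 3 K e, dhomog 3 K n),
    (forall p, f p = F * p :> {mpoly K[3]}) /\ \dim (limg f) = dim (dhomog 3 K e).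
Proof.
move=> hF F0 den.
have hFA (A : dhomog 3 K e) : F * A \is n.-homog.
  exact: homog_mul hF (dhomog_is_dhomog A) den.
pose f0 (A : dhomog 3 K e) : dhomog 3 K n := DHomog (hFA A).
have lf : linear f0 by move=> c u v; apply/val_inj; rewrite /= mulrDr -scalerAr.
pose fl : {linear dhomog 3 K e -> dhomog 3 K n} :=
  HB.pack f0 (GRing.isLinear.Build _ _ _ _ f0 lf).
exists (linfun fl); split=> [p|]; first by rewrite lfunE.
rewrite limg_dim_eq ?dimvf //; apply/eqP; rewrite -subv0; apply/subvP => p.
rewrite memv_cap memv_ker lfunE /= => /andP[_ /eqP /(congr1 val) /= /eqP].
by rewrite mulf_eq0 (negbTE F0) /= => p0; rewrite memv0 -val_eqE.
Qed.

Lemma bezout_bound d e F G N (x : 'I_N -> 'I_3 -> K) :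
  F \is d.-homog -> G \is e.-homog -> F != 0 -> G != 0 ->
  (forall A B, F * A = G * B -> rdvd F B) ->
  (forall i, exists a, x i a != 0) ->
  (forall i j, i != j -> proj_distinct (x i) (x j)) ->
  (forall i, F.@[x i] = 0) -> (forall i, G.@[x i] = 0) ->
  (N <= d * e)%N.
Proof.
move=> hF hG F0 G0 cop x0 xd Fx Gx.
pose D m := dhomog 3 K m; pose n := (N + (d + e))%N.
pose ev0 (p : D n) : 'rV[K]_N := \row_i (mpoly_of_dhomog p).@[x i].
have lev : linear ev0.
  by move=> c p q; apply/rowP => i; rewrite !mxE /= mevalD mevalZ.
pose evL := GRing.isLinear.Build _ _ _ _ ev0 lev.
pose evl : {linear D n -> 'rV[K]_N} := HB.pack ev0 evL.
pose ev := linfun evl.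
have nF : (d + (N + e) = n)%N by rewrite /n; lia.
have nG : (e + (N + d) = n)%N by rewrite /n; lia.
have [f [fE fdim]] := mulhomog_lfun (e := N + e) (n := n) hF F0 nF.
have [g [gE gdim]] := mulhomog_lfun (e := N + d) (n := n) hG G0 nG.
have [h [hE hdim]] := mulhomog_lfun (e := N) (n := n) (dhomogM hF hG)
  (mulf_neq0 F0 G0) (addnC _ _).
have evf : (limg f + limg g <= lker ev)%VS.
  rewrite subv_add; apply/andP; split; apply/subvP => p /memv_imgP[u _ ->].
    rewrite memv_ker !lfunE /=; apply/eqP/rowP => i.
    by rewrite !mxE fE mevalM Fx mul0r.
  rewrite memv_ker !lfunE /=; apply/eqP/rowP => i.
  by rewrite !mxE gE mevalM Gx mul0r.
have capfg : (limg f :&: limg g <= limg h)%VS.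
  apply/subvP => p; rewrite memv_cap => /andP[/memv_imgP[A _ pA] /memv_imgP[B _ pB]].
  have FAGB : F * A = G * B by rewrite -fE -gE -pA -pB.
  have [C BE] := cop _ _ FAGB.
  have hC : C \is N.-homog.
    apply: (homog_quotient (p := F) (d := d)) => //.
    by have := dhomog_is_dhomog B; rewrite /= BE mulrC [(N + d)%N]addnC.
  apply/memv_imgP; exists (DHomog hC); rewrite ?memvf //; apply/val_inj => /=.
  by rewrite hE pB gE BE /=; ring.
have evs : limg ev = fullv.
  apply/eqP; rewrite eqEsubv subvf /=; apply/subvP => v _.
  have sep i : exists p : D n, forall j, ((mpoly_of_dhomog p).@[x j] == 0) = (j != i).
    by have [p hp pP] := separating_form (d + e) i x0 xd; exists (DHomog hp).
  have [p pP] := choice sep.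
  have -> : v = ev (\sum_i (v 0 i / (mpoly_of_dhomog (p i)).@[x i]) *: p i).
    rewrite lfunE /=; apply/rowP => j; rewrite mxE raddf_sum raddf_sum (bigD1 j) //=.
    rewrite mevalZ divfK ?pP ?eqxx // big1 ?addr0 // => i ij.
    by rewrite mevalZ; move: (pP i j); rewrite (eq_sym j) ij => /eqP ->; rewrite mulr0.
  exact: memv_img (memvf _).
have := limg_ker_dim ev fullv; rewrite evs capfv !dimvf => dimev.
have := dimv_sum_cap (limg f) (limg g); rewrite fdim gdim.
have := dimvS evf; have := dimvS capfg; rewrite hdim.
have dN : dim 'rV[K]_N = N by rewrite /dim /= mul1n.
rewrite dN in dimev.
have dD m : (dim (D m) * 2 = m.+2 * m.+1)%N.
  rewrite /dim /= -bin_sub ?leq_addr // addKn addn2 bin2 -[RHS]odd_double_half.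
  by rewrite oddM /= andNb -muln2.
move: (dD (N + e)%N) (dD (N + d)%N) (dD n) (dD N) dimev; rewrite /n.
set a1 := dim _; set a2 := dim _; set a3 := dim _; set a4 := dim _.
set b1 := \dim _; set b2 := \dim _; set b3 := \dim _.
nia.
Qed.
End Bezout.

Lemma irreducible_rdvd (F G A B : {mpoly algC[3]}) :
  mirreducible F -> ~ rdvd F G -> F * A = G * B -> rdvd F B.
Proof.
case=> F0 Fu Firr FG AB.
have [_ _ pF] := ufd_irreducible_prime (ufd_mpoly (n := 3) (@ufd_field algC)) F0 Fu Firr.
by have [//|//] : rdvd F G \/ rdvd F B by apply: pF; exists A; rewrite -AB mulrC.
Qed.

Lemma Z3_neq0 x : Z3 x -> exists a, x a != 0.
Proof.
case=> x0 _ _; apply: contrapT => H; case/eqP: x0; apply/ffunP => a.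
by rewrite ffunE; apply/eqP; apply: contra_notT H => xa; exists a.
Qed.

Lemma Z3_first x : Z3 x -> exists2 i, 0 < x i & forall j : 'I_3, (j < i)%N -> x j = 0.
Proof.
move=> xZ; have [a xa] := Z3_neq0 xZ.
have [i xi imin] := @arg_minnP _ a (fun i => x i != 0) val xa.
have zero (j : 'I_3) : (j < i)%N -> x j = 0.
  by move=> ji; apply/eqP; apply: contraLR ji => /imin; rewrite -leqNgt.
by exists i => //; case: xZ => _ _; apply.
Qed.

Lemma Z3_inj x y : Z3 x -> Z3 y -> (forall a b, x a * y b = x b * y a) -> x = y.
Proof.
move=> xZ yZ prop; have [i xi xmin] := Z3_first xZ.
have [b yb] := Z3_neq0 yZ.
have yi0 : y i != 0.
  apply: contraNneq yb => yi; have := prop i b; rewrite yi mulr0 => /eqP.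
  by rewrite mulf_eq0 (gt_eqF xi).
have yi : 0 < y i.
  have [_ _ yP] := yZ; apply: yP => // j ji; have /eqP := prop i j.
  by rewrite (xmin j) // mul0r mulf_eq0 (gt_eqF xi) => /eqP.
have gcdM (c : int) (z : {ffun 'I_3 -> int}) : 0 < c -> Z3 z ->
    \big[gcdz/0]_(j < 3) (c * z j) = c.
  move=> c0 [_ g _]; rewrite -(big_morph (fun w => c * w) (id1 := 0) (op1 := gcdz) (id2 := 0) (op2 := gcdz)).
  - by rewrite g mulr1.
  - by move=> u v; rewrite -mulz_gcdr gez0_abs // ltW.
  by rewrite mulr0.
have xy : x i = y i.
  rewrite -(gcdM _ _ xi yZ) -(gcdM _ _ yi xZ).
  by apply: eq_bigr => j _; rewrite prop mulrC.
apply/ffunP => j; apply: (mulIf yi0); rewrite -prop xy mulrC.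
by [].
Qed.

Lemma bezout d e (F G : {mpoly algC[3]}) (s : seq {ffun 'I_3 -> int}) :
  mirreducible F -> F \is d.-homog -> G \is e.-homog -> ~ rdvd F G ->
  uniq s -> {in s, forall x, [/\ Z3 x, F.@[fun i => (x i)%:~R] = 0 &
     G.@[fun i => (x i)%:~R] = 0]} -> (size s <= d * e)%N.
Proof.
move=> Firr hF hG FG us sP.
pose x (i : 'I_(size s)) := tnth (in_tuple s) i.
have xs i : x i \in s by apply: mem_tnth.
have F0 : F != 0 by case: Firr.
have G0 : G != 0 by apply: contra_notN FG => /eqP ->; exists 0; rewrite mul0r.
apply: (bezout_bound (F := F) (G := G) (x := fun i a => (x i a)%:~R)) => //.
- by move=> A B; apply: irreducible_rdvd.
- by move=> i; have [/Z3_neq0 [a xa] _ _] := sP _ (xs i); exists a; rewrite intr_eq0.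
- move=> i j ij; apply: contrapT => H.
  have xij : x i = x j.
    have [xi _ _] := sP _ (xs i); have [xj _ _] := sP _ (xs j).
    apply: Z3_inj => // a b; apply/eqP; apply: contra_notT H => H.
    by exists a, b; rewrite -!intrM eqr_int.
  case/eqP: ij; apply/val_inj/eqP; rewrite -(nth_uniq [ffun=> 0] (ltn_ord i) (ltn_ord j) us).
  by move: xij; rewrite /x !(tnth_nth [ffun=> 0]) /= => ->.
- by move=> i; case: (sP _ (xs i)).
- by move=> i; case: (sP _ (xs i)).
Qed.

(** * Siegel's lemma with moduli *)

Lemma siegel (I J : finType) (H : J -> nat) (M : I -> nat) (L : I -> J -> int) :
  (forall i, 0 < M i)%N -> (\prod_i M i < \prod_j (H j).+1)%N ->
  exists a : J -> int, [/\ exists j, a j != 0, forall j, `|a j| <= (H j)%:Z &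
    forall i, ((M i)%:Z %| \sum_j a j * L i j)%Z].
Proof.
move=> M0 ltMH.
pose box := {dffun forall j : J, 'I_(H j).+1}.
pose res := {dffun forall i : I, 'I_(M i).-1.+1}.
pose S (b : box) i := \sum_j (b j : nat)%:Z * L i j.
pose f (b : box) : res := [ffun i => inord `|(S b i %% M i)%Z|%N].
have /injectivePn[b [c bc fbc]] : ~~ injectiveb f.
  apply/negP => /injectiveP injf; have := leq_card f injf.
  rewrite !card_dep_ffun !foldrE !big_image leqNgt /=.
  under eq_bigr do rewrite card_ord prednK //.
  by under [X in (_ < X)%N]eq_bigr do rewrite card_ord; rewrite ltMH.
exists (fun j => (b j : nat)%:Z - (c j : nat)%:Z); split.
- apply: contrapT => E; case/eqP: bc; apply/ffunP => j; apply/val_inj => /=.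
  by apply/eqP; apply: contra_notT E => E; exists j; rewrite subr_eq0 eqz_nat.
- by move=> j; have := ltn_ord (b j); have := ltn_ord (c j); lia.
move=> i; have /ffunP/(_ i)/(congr1 val) := fbc; rewrite !ffunE /=.
have Mi := M0 i; have ltM x : (`|(x %% M i)%Z| < (M i).-1.+1)%N.
  by rewrite prednK // -ltz_nat gez0_abs ?modz_ge0 ?ltz_pmod //; lia.
rewrite !inordK // => /(congr1 Posz); rewrite !gez0_abs ?modz_ge0 //; try lia.
move/eqP; rewrite eqz_mod_dvd /S -sumrB.
by congr (_ %| _)%Z; apply: eq_bigr => j _; rewrite mulrBl.
Qed.

(** * Hensel arcs on an integral curve *)

Lemma horner_subr (R : comNzRingType) (h : {poly R}) (x y : R) :
  exists q, h.[x] - h.[y] = (x - y) * q.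
Proof.
elim/poly_ind: h => [|h c [q IH]]; first by exists 0; rewrite !horner0; ring.
exists (h.[x] + y * q); rewrite !hornerE mulrDr mulrCA -IH; ring.
Qed.

Lemma horner_subr_deriv (R : comNzRingType) (h : {poly R}) (p x y z : R) :
  rdvd p (x - z) -> rdvd p (y - z) ->
  exists q, h.[x] - h.[y] = (x - y) * (h^`().[z] + q * p).
Proof.
move=> [a xz] [b yz]; elim/poly_ind: h => [|h c [q IH]].
  by exists 0; rewrite deriv0 !horner0; ring.
have [r hr] := horner_subr h x z.
exists (a * r + y * q + b * h^`().[z]).
rewrite derivMXaddC !hornerE.
have hx : h.[x] = h.[z] + a * p * r by rewrite -xz -hr addrC subrK.
have -> : h.[x] * x + c - (h.[y] * y + c) = (x - y) * h.[x] + y * (h.[x] - h.[y]) by ring.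
have yE : y = z + b * p by rewrite -yz; ring.
rewrite IH hx; set X := x - y; rewrite [in RHS]yE [in LHS]yE; ring.
Qed.

Lemma hensel_branch (p : int) (f : {poly {poly int}}) (u0 v0 : int) (k : nat) :
  coprimez (f^`().[v0%:P].[u0]) p -> (p %| f.[v0%:P].[u0])%Z ->
  exists g : {poly int}, forall u v, (p %| u - u0)%Z -> (p %| v - v0)%Z ->
    (p ^+ k %| f.[v%:P].[u])%Z -> (p ^+ k %| v - g.[u])%Z.
Proof.
move=> cop f0; pose e u := map_poly (horner_eval u) f.
have eE u (g : {poly int}) : f.[g].[u] = (e u).[g.[u]].
  by rewrite -[LHS]/(horner_eval u _) -horner_map.
have dE u (g : {poly int}) : f^`().[g].[u] = (e u)^`().[g.[u]].
  by rewrite deriv_map -[LHS]/(horner_eval u _) -horner_map.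
have [w wP] : exists w, (p %| 1 - w * f^`().[v0%:P].[u0])%Z.
  move/coprimezP: cop => [[a b] /= ab]; exists a.
  by rewrite -ab addrC addKr dvdz_mull.
suff [g [_ gP]] : exists g : {poly int}, (forall u, (p %| u - u0)%Z -> (p %| g.[u] - v0)%Z) /\
    forall u v, (p %| u - u0)%Z -> (p %| v - v0)%Z ->
    (p ^+ k %| f.[v%:P].[u])%Z -> (p ^+ k %| v - g.[u])%Z.
  by exists g.
elim: k => [|k [g [gv0 IH]]].
  by exists v0%:P; split=> u; rewrite ?hornerC ?subrr // => v _ _; rewrite expr0 dvd1z.
have subd (h : {poly int}) x y : (p %| x - y)%Z -> (p %| h.[x] - h.[y])%Z.
  by move=> xy; have [q ->] := horner_subr h x y; apply: dvdz_mulr.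
(* v |-> v - w f(u, v) contracts the p-adic distance, and zeros of f(u, .) are its fixed points. *)
exists (g - w%:P * f.[g]); split=> [u uu0|u v uu0 vv0 fuv].
  rewrite !hornerE addrAC; apply: rpredB; first exact: gv0.
  apply: dvdz_mull; rewrite -[X in (_ %| X)%Z](subrK (f.[v0%:P].[u])).
  apply: rpredD; first by rewrite !eE hornerC; apply/subd/gv0.
  by rewrite -[X in (_ %| X)%Z](subrK (f.[v0%:P].[u0])); apply: rpredD => //; apply: subd.
have pv : (p ^+ k %| v - g.[u])%Z.
  by apply: IH => //; apply: dvdz_trans fuv; rewrite exprS dvdz_mull.
rewrite !hornerE.
have -> : v - (g.[u] - w * f.[g].[u]) =
  v - g.[u] - w * (f.[v%:P].[u] - f.[g].[u]) + w * f.[v%:P].[u] by ring.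
apply: rpredD; last exact: dvdz_mull.
have d2 x : (p %| x - v0)%Z -> rdvd p (x - v0) by case/dvdzP=> c ->; exists c.
rewrite !eE hornerC; have [q ->] := horner_subr_deriv (e u) (d2 _ vv0) (d2 _ (gv0 _ uu0)).
rewrite mulrCA -{1}[v - g.[u]]mulr1 -mulrBr exprSr; apply: dvdz_mul => //.
rewrite -[v0](hornerC v0 u) -dE.
have -> : 1 - w * (f^`().[v0%:P].[u] + q * p) = (1 - w * f^`().[v0%:P].[u0]) -
  w * (f^`().[v0%:P].[u] - f^`().[v0%:P].[u0]) - w * q * p by ring.
apply: rpredB; last exact: dvdz_mull.
by apply: rpredB => //; apply/dvdz_mull/subd.
Qed.

Lemma rmorph_mmap (n : nat) (R S T : comNzRingType) (f : {rmorphism R -> S})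
    (g : {rmorphism S -> T}) (h : 'I_n -> S) (p : {mpoly R[n]}) :
  g (mmap f h p) = mmap (g \o f) (g \o h) p.
Proof.
rewrite /mmap rmorph_sum; apply: eq_bigr => m _; rewrite rmorphM /mmap1 rmorph_prod.
by congr (_ * _); apply: eq_bigr => i _; rewrite rmorphXn.
Qed.

Lemma mmap_meval (n : nat) (R : comNzRingType) (f : R -> R) (h y : 'I_n -> R)
  (p : {mpoly R[n]}) : f =1 id -> h =1 y -> mmap f h p = p.@[y].
Proof.
move=> fE hE; rewrite mevalE /mmap; apply: eq_bigr => m _.
by rewrite fE; congr (_ * _); apply: eq_bigr => i _; rewrite hE.
Qed.

Lemma deriv_mmap (n : nat) (R S : comNzRingType) (f : {rmorphism R -> S})
    (Y : 'I_n -> {poly S}) (k : 'I_n) (p : {mpoly R[n]}) :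
  Y k = 'X -> (forall i, i != k -> exists c, Y i = c%:P) ->
  (mmap (polyC \o f) Y p)^`() = mmap (polyC \o f) Y p^`M(k).
Proof.
move=> Yk Yi; elim/mpolyind: p => [|c m p _ _ IH].
  by rewrite mderiv0 !mmap0 deriv0.
rewrite mderivD !mmapD derivD IH; congr (_ + _).
rewrite mderivZ !mmapZ /= mmapX mderivX mmapZ mmapX /= mul_polyC derivZ mul_polyC.
congr (_ *: _); rewrite /mmap1 (bigD1 k) //= [in RHS](bigD1 k) //= Yk.
have [e eE] : exists e, \prod_(i < n | i != k) Y i ^+ m i = e%:P.
  elim/big_rec: _ => [|i x ik [e ->]]; first by exists 1.
  by have [c' ->] := Yi i ik; exists (c' ^+ m i * e); rewrite polyCM polyC_exp.
have <- : \prod_(i < n | i != k) Y i ^+ m i = \prod_(i < n | i != k) Y i ^+ (m - U_(k))%MM i.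
  by apply: eq_bigr => i ik; rewrite mnmBE mnm1E eq_sym (negbTE ik) subn0.
rewrite eE mnmBE mnm1E eqxx subn1 mulrC mul_polyC derivZ derivXn rmorph_nat.
by rewrite -mul_polyC polyC_natr -mulr_natl; ring.
Qed.

Definition chart_pt (R : nzRingType) (i k : 'I_3) (u v : R) (j : 'I_3) : R :=
  if j == i then 1 else if j == k then v else u.

Definition local_eq (F : {mpoly int[3]}) (i k : 'I_3) : {poly {poly int}} :=
  mmap (polyC \o polyC) (chart_pt i k 'X%:P 'X) F.

Lemma local_eqE F i k (u v : int) : (local_eq F i k).[v%:P].[u] = F.@[chart_pt i k u v].
Proof.
rewrite -[LHS]/((horner_eval u) (horner_eval v%:P _)) /local_eq !rmorph_mmap.
apply: mmap_meval => [c|j] /=; rewrite /horner_eval ?hornerC //.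
by rewrite /chart_pt; case: ifP => _; [rewrite !hornerE|case: ifP => _; rewrite !(hornerX, hornerC)].
Qed.

Lemma deriv_local_eqE F i k (u v : int) : k != i ->
  (local_eq F i k)^`().[v%:P].[u] = (F^`M(k)).@[chart_pt i k u v].
Proof.
move=> ki; rewrite -local_eqE /local_eq (@deriv_mmap _ _ _ _ _ k) //.
  by rewrite /chart_pt (negbTE ki) eqxx.
move=> j jk; rewrite /chart_pt (negbTE jk); case: ifP => _; first by exists 1.
by exists 'X.
Qed.

Lemma meval_homog (R : comNzRingType) n d (F : {mpoly R[n]}) (c : R) (y : 'I_n -> R) :
  F \is d.-homog -> F.@[fun j => c * y j] = c ^+ d * F.@[y].
Proof.
move=> /dhomogP hF; rewrite !mevalE mulr_sumr; apply: eq_big_seq => m /hF dm.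
rewrite mulrCA; congr (_ * _); rewrite -dm /= mdegE -prodrXr -big_split /=.
by apply: eq_bigr => i _; rewrite exprMn.
Qed.

Lemma dvdz_meval n (F : {mpoly int[n]}) (q : int) (x y : 'I_n -> int) :
  (forall j, (q %| x j - y j)%Z) -> (q %| F.@[x] - F.@[y])%Z.
Proof.
move=> xy; rewrite !mevalE -sumrB rpred_sum // => m _.
rewrite -mulrBr dvdz_mull // -eqz_mod_dvd; apply/eqP.
elim/big_rec2: _ => // j a b _ ab; rewrite -modzMm ab modzMm.
rewrite -modzMml -(modzXm _ (x j)).
have /eqP -> : (x j == y j %[mod q])%Z by rewrite eqz_mod_dvd.
by rewrite modzXm modzMml.
Qed.

Lemma local_param (p : nat) (F : {mpoly int[3]}) (d s : nat) (i k : 'I_3) (u0 v0 : int) :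
  prime p -> k != i -> F \is d.-homog ->
  (p%:Z %| F.@[chart_pt i k u0 v0])%Z -> ~~ (p%:Z %| (F^`M(k)).@[chart_pt i k u0 v0])%Z ->
  exists y : 'I_3 -> {poly int}, forall x : 'I_3 -> int,
    ~~ (p%:Z %| x i)%Z -> (forall j, (p%:Z %| x j - x i * chart_pt i k u0 v0 j)%Z) ->
    F.@[x] = 0 -> exists c t, (p%:Z %| t)%Z /\
      forall j, (p%:Z ^+ s %| x j - c * (y j).[t])%Z.
Proof.
move=> pp ki hF F0 dF.
have cop (a : int) : ~~ (p%:Z %| a)%Z -> coprimez a p%:Z.
  by rewrite /dvdz /coprimez /gcdz /= -prime_coprime // coprime_sym /coprime => /eqP ->.
have cop_df : coprimez ((local_eq F i k)^`().[v0%:P].[u0]) p%:Z.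
  by rewrite deriv_local_eqE //; apply: cop.
have dvd_f : (p%:Z %| (local_eq F i k).[v0%:P].[u0])%Z by rewrite local_eqE.
have [g gP] := hensel_branch (p := p) (f := local_eq F i k) (u0 := u0) (v0 := v0) s
  cop_df dvd_f.
have [j [ji jk]] : exists j : 'I_3, j != i /\ j != k.
  by case: i k {F0 dF cop_df dvd_f gP} ki => [[|[|[|?]]] ?] [[|[|[|?]]] ?] //= _;
    solve [by exists 0 | by exists 1 | by exists (inord 2); rewrite -!val_eqE /= inordK].
exists (fun l => (chart_pt i k 'X g l) \Po ('X + u0%:P)) => x xi xj Fx.
have /coprimezP[[w b] /= wb] : coprimez (x i) (p%:Z ^+ s).
  by apply: coprimezXr; apply: cop.
have wx : (p%:Z ^+ s %| 1 - w * x i)%Z by rewrite -wb addrC addKr dvdz_mull.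
have [wp|s0] := boolP (p%:Z %| 1 - w * x i)%Z; last first.
  exists 0, 0; split=> // l; suff -> : s = 0%N by rewrite expr0 dvd1z.
  apply/eqP; rewrite -leqn0 leqNgt; apply: contra s0 => s0.
  by apply: dvdz_trans wx; rewrite -(prednK s0) exprS dvdz_mulr.
have near l : (p%:Z %| w * x l - chart_pt i k u0 v0 l)%Z.
  have -> : w * x l - chart_pt i k u0 v0 l = w * (x l - x i * chart_pt i k u0 v0 l) -
    (1 - w * x i) * chart_pt i k u0 v0 l by ring.
  by apply: rpredB; [apply: dvdz_mull|apply: dvdz_mulr].
set u := w * x j; set v := w * x k.
have uu : (p%:Z %| u - u0)%Z by have := near j; rewrite /chart_pt (negbTE ji) (negbTE jk).
have vv : (p%:Z %| v - v0)%Z by have := near k; rewrite /chart_pt (negbTE ki) eqxx.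
have l3 l : [|| l == i, l == k | l == j].
  case: i k j l {F0 dF cop_df dvd_f gP xi xj wb wx wp near u v uu vv} ki ji jk =>
    [[|[|[|?]]] ?] [[|[|[|?]]] ?] [[|[|[|?]]] ?] [[|[|[|?]]] ?] //=.
have ptE l : (p%:Z ^+ s %| w * x l - chart_pt i k u v l)%Z.
  case/or3P: (l3 l) => /eqP ->;
    rewrite /chart_pt ?eqxx ?(negbTE ki) ?(negbTE ji) ?(negbTE jk) ?subrr ?dvdz0 //.
  by rewrite -opprB rpredN.
have fuv : (p%:Z ^+ s %| (local_eq F i k).[v%:P].[u])%Z.
  rewrite local_eqE; have := dvdz_meval F ptE.
  by rewrite (meval_homog _ _ hF) Fx mulr0 sub0r rpredN.
have gu := gP u v uu vv fuv.
exists (x i), (u - u0); split=> // l; rewrite horner_comp !hornerE subrK.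
have -> : x l - x i * (chart_pt i k 'X g l).[u] = (1 - w * x i) * x l +
   x i * (w * x l - (chart_pt i k 'X g l).[u]) by ring.
apply: rpredD; first exact: dvdz_mulr.
apply: dvdz_mull; case/or3P: (l3 l) => /eqP ->;
  rewrite /chart_pt ?eqxx ?(negbTE ki) ?(negbTE ji) ?(negbTE jk) ?hornerC ?hornerX
    ?subrr ?dvdz0 //.
by rewrite -opprB rpredN.
Qed.

Lemma PoszX (m n : nat) : (m ^ n)%N = m%:Z ^+ n :> int.
Proof. by elim: n => // n IH; rewrite expnS exprS PoszM IH. Qed.

Lemma dvdz_horner (q : int) (h : {poly int}) (p t : int) s :
  (p %| t)%Z -> (forall l : 'I_s, (p ^+ (s - l) %| h`_l)%Z) -> (p ^+ s %| h.[t])%Z.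
Proof.
move=> chart_pt hl; rewrite horner_coef rpred_sum // => l _.
have [ls|sl] := ltnP l s; last first.
  by rewrite dvdz_mull // -(subnK sl) exprD dvdz_mull // dvdz_exp2r.
rewrite -{1}(subnK (ltnW ls)) exprD dvdz_mul ?dvdz_exp2r //.
exact: (hl (Ordinal ls)).
Qed.

Lemma aux_form (p : nat) (F : {mpoly int[3]}) (d D s : nat) (i k : 'I_3) (u0 v0 : int)
    (e : 'I_s -> 'X_{1..3}) (H : 'I_s -> nat) :
  prime p -> k != i -> F \is d.-homog ->
  (p%:Z %| F.@[chart_pt i k u0 v0])%Z -> ~~ (p%:Z %| (F^`M(k)).@[chart_pt i k u0 v0])%Z ->
  (forall j, mdeg (e j) = D) ->
  (\prod_(l < s) p ^ (s - l) < \prod_j (H j).+1)%N ->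
  exists a : 'I_s -> int, [/\ exists j, a j != 0, forall j, `|a j| <= (H j)%:Z &
    forall x : 'I_3 -> int,
    ~~ (p%:Z %| x i)%Z -> (forall j, (p%:Z %| x j - x i * chart_pt i k u0 v0 j)%Z) ->
    F.@[x] = 0 -> (\sum_j H j * \prod_l `|x l| ^ e j l < p ^ s)%N ->
    (\sum_j a j *: 'X_[e j]).@[x] = 0].
Proof.
move=> pp ki hF F0 dF eD ltH.
have [y yP] := local_param s pp ki hF F0 dF.
pose L (l : 'I_s) j := (\prod_r y r ^+ e j r)`_l.
have [|a [a0 aH aL]] := siegel L _ ltH.
  by move=> l; rewrite expn_gt0 prime_gt0.
exists a; split=> // x xi xj Fx small.
have [c [t [tp xt]]] := yP x xi xj Fx.
set A := \sum_j _.
have Ax : A.@[x] = \sum_j a j * \prod_l x l ^+ e j l.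
  by rewrite /A raddf_sum /=; apply: eq_bigr => j _; rewrite mevalZ mevalX.
have Ay : A.@[fun l => (y l).[t]] = (\sum_j (a j) *: \prod_r y r ^+ e j r).[t].
  rewrite horner_sum /A raddf_sum; apply: eq_bigr => j _.
  rewrite /= mevalZ mevalX hornerZ horner_prod; congr (_ * _).
  by apply: eq_bigr => r _; rewrite horner_exp.
have hA : A \is D.-homog.
  by rewrite rpred_sum // => j _; rewrite rpredZ // dhomogX /= eD.
have dA : (p%:Z ^+ s %| A.@[x])%Z.
  rewrite -[X in (_ %| X)%Z](subrK (A.@[fun l => c * (y l).[t]])).
  apply: rpredD; first exact: dvdz_meval.
  rewrite (meval_homog _ _ hA) dvdz_mull // Ay; apply: dvdz_horner => // l.
  rewrite coef_sum -PoszX; have := aL l; congr (_ %| _)%Z.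
  by apply: eq_bigr => j _; rewrite coefZ.
apply/eqP; apply: contraLR small => Ax0; rewrite -leqNgt.
move: dA; rewrite dvdzE abszX absz_nat => dA; apply: leq_trans (dvdn_leq _ dA) _; first by rewrite absz_gt0.
rewrite Ax -lez_nat abszE; apply: le_trans (ler_norm_sum _ _ _) _.
rewrite (big_morph Posz PoszD (erefl 0)); apply: ler_sum => j _.
rewrite normrM PoszM (big_morph Posz PoszM (erefl 1)) normr_prod.
apply: ler_pM => //; first by rewrite prodr_ge0.
apply: ler_prod => l _; rewrite normr_ge0 /= normrX.
by rewrite PoszX abszE.
Qed.

(** * Monomials weighted by the box *)

Section Monomials.
Variable R : realType.
Implicit Types (B : 'I_3 -> R).

Definition weight B (m : 'X_{1..3}) : R := \prod_(i < 3) B i ^+ m i.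

Lemma weightD B m1 m2 : weight B (m1 + m2) = weight B m1 * weight B m2.
Proof.
by rewrite /weight -big_split; apply: eq_bigr => i _; rewrite mnmDE exprD.
Qed.

Lemma weight_ge1 B m : (forall i, 1 <= B i) -> 1 <= weight B m.
Proof.
move=> B1; rewrite /weight; elim/big_rec: _ => // i x _ x1.
by rewrite mulr_ege1 // exprn_ege1.
Qed.

Lemma weight_gt0 B m : (forall i, 1 <= B i) -> 0 < weight B m.
Proof. by move=> B1; apply: lt_le_trans (weight_ge1 m B1). Qed.

(** Ties in the weight are broken by the monomial order, so that [m] is the leading monomial
    of [p] for an order compatible with multiplication. *)
Lemma max_monomial (K : nzRingType) B (p : {mpoly K[3]}) : p != 0 ->
  exists2 m, m \in msupp p & forall m', m' \in msupp p ->
    weight B m' < weight B m \/ weight B m' = weight B m /\ (m' <= m)%O.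
Proof.
rewrite -msupp_eq0; elim: (msupp p) => // m1 [|m2 s] IH _.
  by exists m1; rewrite ?inE // => m'; rewrite inE => /eqP ->; right.
have [//|m ms mP] := IH; set t := _ :: s in ms mP.
have [w|w|w] := ltgtP (weight B m1) (weight B m).
- exists m; first by rewrite inE ms orbT.
  by move=> m'; rewrite inE => /orP[/eqP -> |/mP //]; left.
- exists m1; first by rewrite mem_head.
  move=> m'; rewrite inE => /orP[/eqP -> |/mP [w'|[w' _]]]; first by right.
    by left; apply: lt_trans w.
  by left; rewrite w'.
have [le1|lt1] := leP m1 m.
  exists m; first by rewrite inE ms orbT.
  by move=> m'; rewrite inE => /orP[/eqP -> |/mP //]; right.
exists m1; first by rewrite mem_head.
move=> m'; rewrite inE w => /orP[/eqP -> |/mP [w'|[w' le']]]; first by right.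
  by left.
by right; split=> //; apply: le_trans le' (ltW lt1).
Qed.

Lemma mcoeffM_unique (K : nzRingType) n (p q : {mpoly K[n]}) a b :
  (forall m1 m2, m1 \in msupp p -> m2 \in msupp q -> (m1 + m2 = a + b)%MM -> m1 = a) ->
  (p * q)@_(a + b) = p@_a * q@_b.
Proof.
move=> uniq_ab; rewrite mpolyME big_allpairs raddf_sum /=.
have inner m1 : (\sum_(m2 <- msupp q) (p@_m1 * q@_m2) *: 'X_[m1 + m2])@_(a + b) =
    \sum_(m2 <- msupp q) p@_m1 * q@_m2 * ((m1 + m2)%MM == (a + b)%MM)%:R.
  by rewrite raddf_sum; apply: eq_bigr => m2 _ /=; rewrite mcoeffZ mcoeffX.
under eq_bigr do rewrite inner.
have zero m1 m2 : m1 \in msupp p -> m2 \in msupp q -> m1 != a ->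
    p@_m1 * q@_m2 * ((m1 + m2)%MM == (a + b)%MM)%:R = 0.
  move=> m1p m2q /eqP m1a; case: eqP => [/(uniq_ab _ _ m1p m2q) //|_].
  by rewrite mulr0.
have [ap|ap] := boolP (a \in msupp p); last first.
  rewrite (memN_msupp_eq0 ap) mul0r big_seq big1 // => m1 m1p.
  rewrite big_seq big1 // => m2 m2q; apply: zero => //.
  by apply: contraNneq ap => <-.
rewrite (bigD1_seq a) ?msupp_uniq //= [X in _ + X]big1_seq ?addr0; last first.
  by move=> m1 /andP[m1a m1p]; apply: big1_seq => m2 /andP[_ m2q]; apply: zero.
have [bq|bq] := boolP (b \in msupp q); last first.
  rewrite (memN_msupp_eq0 bq) mulr0; apply: big1_seq => m2 /andP[_ m2q].
  by rewrite eqm_add2l; case: eqP => [m2b|]; rewrite ?mulr0 //; rewrite m2b (negbTE bq) in m2q.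
rewrite (bigD1_seq b) ?msupp_uniq //= eqxx mulr1 big1 ?addr0 // => m2 m2b.
by rewrite eqm_add2l (negbTE m2b) mulr0.
Qed.

Lemma max_monomial_dvd (K : idomainType) B (F G : {mpoly K[3]}) m :
  (forall i, 1 <= B i) -> m \in msupp F ->
  (forall m', m' \in msupp F ->
    weight B m' < weight B m \/ weight B m' = weight B m /\ (m' <= m)%O) ->
  G != 0 -> rdvd F G -> exists2 e, e \in msupp G & (m <= e)%MM.
Proof.
move=> B1 mF mP G0 [Q GE]; have Q0 : Q != 0 by apply: contraNneq G0 => z; rewrite GE z mul0r.
have [q qQ qP] := max_monomial B Q0.
exists (m + q)%MM; last exact: lem_addr.
rewrite mcoeff_msupp GE mulrC mcoeffM_unique ?mulf_neq0 -?mcoeff_msupp //.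
move=> m1 m2 m1F m2Q eqm; have /(congr1 (weight B)) := eqm; rewrite !weightD.
have wlt : weight B m2 <= weight B q by case: (qP _ m2Q) => [/ltW|[->]].
have [lt1|[e1 l1]] := mP _ m1F.
  move/eqP; rewrite lt_eqF //; apply: (@lt_le_trans _ _ (weight B m * weight B m2)).
    by rewrite ltr_pM2r ?weight_gt0.
  by rewrite ler_pM2l ?weight_gt0.
rewrite e1 => /(mulfI (lt0r_neq0 (weight_gt0 m B1))) e2.
have l2 : (m2 <= q)%O by case: (qP _ m2Q) => [|[]//]; rewrite e2 ltxx.
move: l1; rewrite le_eqVlt => /orP[/eqP //|l1].
by have := ltmc_le_add l1 l2; rewrite eqm ltxx.
Qed.

Definition monomials D : seq 'X_{1..3} := [seq s2m t | t : D.-tuple 'I_3 <- enum (basis 3 D)].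

Lemma mem_monomials D m : (m \in monomials D) = (mdeg m == D).
Proof. by rewrite basis_cover. Qed.

Lemma monomials_uniq D : uniq (monomials D).
Proof. exact: uniq_basis. Qed.

Lemma size_monomials D : size (monomials D) = 'C(D.+2, 2).
Proof. by rewrite size_basis -bin_sub ?leq_addr // addKn addn2. Qed.

Lemma monomials_multiples n m :
  perm_eq [seq e <- monomials (mdeg m + n) | (m <= e)%MM] [seq (m + e)%MM | e <- monomials n].
Proof.
apply: uniq_perm.
- by rewrite filter_uniq // monomials_uniq.
- by rewrite map_inj_uniq ?monomials_uniq // => a b /addmI.
move=> e; rewrite mem_filter mem_monomials; apply/andP/mapP => [[me /eqP dege]|[f fn ->]].
  exists (e - m)%MM; last by rewrite addmC submK.
  by rewrite mem_monomials -(eqn_add2l (mdeg m)) -mdegD addmC submK // dege.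
by rewrite lem_addr mdegD eqn_add2l -mem_monomials fn.
Qed.

Lemma sum_monomials D i : (\sum_(e <- monomials D) e i = 'C(D.+2, 3))%N.
Proof.
elim: D => [|D IH].
  rewrite big_seq big1 // => e; rewrite mem_monomials mdeg_eq0 => /eqP ->.
  by rewrite mnm0E.
rewrite (bigID (fun e => (U_(i) <= e)%MM)) /= [X in (_ + X)%N]big1 ?addn0; last first.
  by move=> e; rewrite lep1mP negbK => /eqP.
have := monomials_multiples D U_(i); rewrite mdeg1 add1n => multiples.
rewrite -big_filter (perm_big _ multiples) /= big_map.
under eq_bigr do rewrite mnmDE mnm1E eqxx.
by rewrite big_split IH /= sum1_size size_monomials [RHS]binS addnC.
Qed.

Lemma prod_monomials B D : \prod_(e <- monomials D) weight B e = (\prod_i B i) ^+ 'C(D.+2, 3).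
Proof.
rewrite /weight exchange_big /= -prodrXl; apply: eq_bigr => i _.
by rewrite -(sum_monomials D i) prodrXr.
Qed.

Definition aux_monomials n m := [seq e <- monomials (mdeg m + n) | ~~ (m <= e)%MM].

Lemma size_aux_monomials n m :
  (size (aux_monomials n m) + 'C(n.+2, 2) = 'C((mdeg m + n).+2, 2))%N.
Proof.
rewrite -!size_monomials -(size_map (fun e => m + e)%MM (monomials n)).
rewrite -(perm_size (monomials_multiples n m)) !size_filter addnC.
by rewrite count_predC.
Qed.

Lemma prod_aux_monomials B n m :
  \prod_(e <- aux_monomials n m) weight B e *
  (weight B m ^+ 'C(n.+2, 2) * (\prod_i B i) ^+ 'C(n.+2, 3)) =
  (\prod_i B i) ^+ 'C((mdeg m + n).+2, 3).
Proof.
rewrite -!prod_monomials [RHS](bigID (fun e => (m <= e)%MM)) /= mulrC; congr (_ * _).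
  rewrite -[RHS]big_filter [RHS](perm_big _ (monomials_multiples n m)) [RHS]big_map.
  rewrite [RHS](eq_bigr (fun e => weight B m * weight B e)); last first.
    by move=> e _; rewrite weightD.
  rewrite big_split /=; congr (_ * _).
  by rewrite big_const_seq count_predT size_monomials -Monoid.iteropE.
by rewrite big_filter.
Qed.
End Monomials.

Lemma bin2_double n : ('C(n, 2) * 2 = n * n.-1)%N.
Proof.
by rewrite bin2 -[RHS]odd_double_half oddM; case: n => // n; rewrite /= andNb -muln2.
Qed.

Lemma prod_descending_pow (p s : nat) : (\prod_(l < s) p ^ (s - l) = p ^ 'C(s.+1, 2))%N.
Proof.
elim: s => [|s IH]; first by rewrite big_ord0.
by rewrite big_ord_recl subn0 binS bin1 expnD mulnC -IH.
Qed.

Lemma class_form (R : realType) (B : 'I_3 -> R) (F : {mpoly int[3]}) (d n p : nat)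
    (m : 'X_{1..3}) (i k : 'I_3) (u0 v0 : int) (s := size (aux_monomials n m)) :
  (forall l, 1 <= B l) -> F \is d.-homog -> prime p -> k != i ->
  (p%:Z %| F.@[chart_pt i k u0 v0])%Z -> ~~ (p%:Z %| (F^`M(k)).@[chart_pt i k u0 v0])%Z ->
  (0 < s)%N ->
  s.+1%:R ^+ s * \prod_(e <- aux_monomials n m) weight B e <= p%:R ^+ 'C(s, 2) ->
  exists G : {mpoly int[3]}, [/\ G != 0, G \is (mdeg m + n).-homog,
    {subset msupp G <= aux_monomials n m} & forall x : 'I_3 -> int,
    (forall l, `|(x l)%:~R| <= B l) ->
    ~~ (p%:Z %| x i)%Z -> (forall j, (p%:Z %| x j - x i * chart_pt i k u0 v0 j)%Z) ->
    F.@[x] = 0 -> G.@[x] = 0].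
Proof.
move=> B1 hF pp ki F0 dF s0 big_p; pose E := in_tuple (aux_monomials n m).
pose e (j : 'I_s) := tnth E j.
have eE j : e j \in aux_monomials n m by apply: mem_tnth.
have eD j : mdeg (e j) = (mdeg m + n)%N.
  by have := eE j; rewrite mem_filter mem_monomials => /andP[_ /eqP].
have e_inj : injective e.
  move=> j l; rewrite /e !(tnth_nth 0%MM) /= => jl; apply/val_inj/eqP.
  by rewrite -(nth_uniq 0%MM (ltn_ord j) (ltn_ord l) (filter_uniq _ (monomials_uniq _))) jl.
have prodE (f : 'X_{1..3} -> R) : \prod_(e <- aux_monomials n m) f e = \prod_j f (e j).
  by rewrite (big_nth 0%MM) big_mkord; apply: eq_bigr => j _; rewrite /e (tnth_nth 0%MM).
pose h j : R := p%:R ^+ s / (s.+1%:R * weight B (e j)).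
have p0 : 0 < p%:R :> R by rewrite ltr0n prime_gt0.
have W0 j : 0 < weight B (e j) by apply: weight_gt0.
have h0 j : 0 < h j by rewrite divr_gt0 ?mulr_gt0 ?exprn_gt0.
pose H j := Num.truncn (h j).
have Hle j : (H j)%:R <= h j by have /andP[] := truncn_itv (ltW (h0 j)).
have Hlt j : h j < (H j).+1%:R by have /andP[] := truncn_itv (ltW (h0 j)).
have ltH : (\prod_(l < s) p ^ (s - l) < \prod_j (H j).+1)%N.
  rewrite prod_descending_pow -(ltr_nat R) natrX natr_prod.
  apply: le_lt_trans (_ : _ <= \prod_j h j) _; last first.
    apply: ltr_prod => [|j _]; last by rewrite ltW ?h0 /=.
    by apply/hasP; exists (Ordinal s0); rewrite ?mem_index_enum.
  rewrite /h prodf_div prodr_const card_ord -exprM big_split /= prodr_const card_ord.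
  rewrite ler_pdivlMr; last by rewrite mulr_gt0 ?exprn_gt0 ?ltr0n ?prodr_gt0.
  rewrite -prodE; apply: le_trans (_ : p%:R ^+ 'C(s.+1, 2) * p%:R ^+ 'C(s, 2) <= _).
    by rewrite ler_pM2l // exprn_gt0.
  rewrite -exprD; suff -> : ('C(s.+1, 2) + 'C(s, 2) = s * s)%N by [].
  by rewrite binS bin1; have := bin2_double s; case: (s) => //= r; lia.
have [a [[j0 aj0] aH aP]] := aux_form pp ki hF F0 dF eD ltH.
exists (\sum_j a j *: 'X_[e j]); split.
- apply: contraNneq aj0 => /(congr1 (mcoeff (e j0))).
  rewrite mcoeff0 raddf_sum (bigD1 j0) //= mcoeffZ mcoeffX eqxx mulr1 big1 ?addr0 => [->//|j jj0].
  by rewrite mcoeffZ mcoeffX (inj_eq e_inj) (negbTE jj0) mulr0.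
- by rewrite rpred_sum // => j _; rewrite rpredZ // dhomogX /= eD.
- move=> b; rewrite mcoeff_msupp raddf_sum; apply: contraR => bE.
  apply/eqP/big1 => j _ /=; rewrite mcoeffZ mcoeffX; case: eqP => [ejb|]; last by rewrite mulr0.
  by rewrite -ejb eE in bE.
move=> x xB xi xj Fx; apply: aP => //.
rewrite -(ltr_nat R) natr_sum natrX.
apply: le_lt_trans (_ : _ <= \sum_(j < s) p%:R ^+ s / s.+1%:R) _; last first.
  rewrite sumr_const card_ord -[X in X < _]mulr_natr mulrAC ltr_pdivrMr ?ltr0n //.
  by rewrite ltr_pM2l ?exprn_gt0 // ltr_nat.
apply: ler_sum => j _; rewrite natrM natr_prod.
apply: le_trans (_ : h j * weight B (e j) <= _); last first.
  by rewrite /h invfM mulrA divfK // gt_eqF.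
apply: ler_pM => //; first by rewrite prodr_ge0.
apply: ler_prod => l _; rewrite ler0n natrX /= lerXn2r ?nnegrE ?ler0n //.
  exact: le_trans (xB l).
by have := xB l; rewrite natr_absz intr_norm.
Qed.

(** * Counting points modulo a prime *)

Definition toC (F : {mpoly int[3]}) : {mpoly algC[3]} := map_mpoly (intr : int -> algC) F.

Lemma mcoeff_toC F m : (toC F)@_m = (F@_m)%:~R.
Proof. by rewrite mcoeff_map_mpoly. Qed.

Lemma msupp_toC F : msupp (toC F) =i msupp F.
Proof. by move=> m; rewrite !mcoeff_msupp mcoeff_toC intr_eq0. Qed.

Lemma toC_eq0 F : (toC F == 0) = (F == 0).
Proof.
apply/eqP/eqP => [F0|->]; last by rewrite /toC raddf0.
apply/mpolyP => m; have := congr1 (mcoeff m) F0.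
by rewrite mcoeff_toC !mcoeff0 => /eqP; rewrite intr_eq0 => /eqP.
Qed.

Lemma toC_homog d F : (toC F \is d.-homog) = (F \is d.-homog).
Proof.
by apply/dhomogP/dhomogP => hF m; have := hF m; rewrite msupp_toC.
Qed.

Lemma meval_toC F (x : 'I_3 -> int) : (toC F).@[fun i => (x i)%:~R] = (F.@[x])%:~R.
Proof.
elim/mpolyind: F => [|c m F _ _ IH]; first by rewrite /toC raddf0 !meval0.
rewrite /toC raddfD /= !mevalD -/(toC F) IH rmorphD; congr (_ + _).
rewrite map_mpolyZ map_mpolyX !mevalZ !mevalX rmorphM rmorph_prod; congr (_ * _).
by apply: eq_bigr => i _; rewrite rmorphXn.
Qed.

Lemma deriv_homog (R : nzRingType) n d k (F : {mpoly R[n]}) :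
  F \is d.-homog -> F^`M(k) \is d.-1.-homog.
Proof.
move=> /dhomogP hF; apply/dhomogP => m; rewrite mcoeff_msupp mcoeff_deriv => H.
have : (m + U_(k))%MM \in msupp F.
  by rewrite mcoeff_msupp; apply: contraNneq H => ->; rewrite mul0rn.
by move/hF => /= <-; rewrite mdegD mdeg1 addn1.
Qed.

Lemma euler_identity (R : comNzRingType) n d (F : {mpoly R[n]}) : F \is d.-homog ->
  \sum_k 'X_k * F^`M(k) = F *+ d.
Proof.
move=> /dhomogP hF; apply/mpolyP => m; rewrite raddf_sum /= mcoeffMn.
have term k : ('X_k * F^`M(k))@_m = F@_m *+ m k.
  have [mk|mk] := boolP (U_(k) <= m)%MM.
    rewrite -{1}(submK mk) addmC mulrC mcoeffMX mcoeff_deriv submK //.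
    by rewrite mnmBE mnm1E eqxx subn1 prednK // lt0n -lep1mP.
  rewrite lep1mP negbK in mk; rewrite (eqP mk) mulr0n.
  apply: memN_msupp_eq0; rewrite mulrC (perm_mem (msuppMX _ _)).
  by apply: contraL mk => /mapP[m' _ ->]; rewrite mnmDE mnm1E eqxx.
rewrite (eq_bigr _ (fun k _ => term k)) sumrMnr -mdegE.
have [mF|/memN_msupp_eq0 ->] := boolP (m \in msupp F); last by rewrite !mul0rn.
by rewrite -(hF m mF).
Qed.

Lemma euler_eval (R : comNzRingType) n d (F : {mpoly R[n]}) (x : 'I_n -> R) :
  F \is d.-homog -> \sum_k x k * (F^`M(k)).@[x] = F.@[x] *+ d.
Proof.
move=> hF; rewrite -mevalMn -(euler_identity hF) raddf_sum /=.
by apply: eq_bigr => k _; rewrite mevalM mevalXU.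
Qed.

Lemma size_mmap_leq (R S : comNzRingType) n (d : nat) (f : {rmorphism R -> S})
    (Y : 'I_n -> {poly S}) (F : {mpoly R[n]}) :
  F \is d.-homog -> (forall i, (size (Y i) <= 2)%N) ->
  (size (mmap (polyC \o f) Y F) <= d.+1)%N.
Proof.
move=> /dhomogP hF sY; rewrite /mmap big_seq; apply: (leq_trans (size_sum _ _ _)).
apply/bigmax_leqP_seq => m mF _; rewrite /= mul_polyC.
apply: leq_trans (size_scale_leq _ _) _; apply: leq_trans (size_poly_prod_leq _ _) _.
rewrite -(hF m mF) /= mdegE leq_subLR -[in X in (_ <= X)%N]sum1_card addnS ltnS.
rewrite -big_split /=; apply: leq_sum => i _; apply: leq_trans (size_poly_exp_leq _ _) _.
by rewrite add1n ltnS -[X in (_ <= X)%N]mul1n leq_mul2r; apply/orP; right; have := sY i; lia.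
Qed.

Lemma residue_roots (p : nat) d (F : {mpoly int[3]}) (i k : 'I_3) (u : int) :
  prime p -> k != i -> F \is d.-homog ->
  (#|[set v : 'I_p | (p%:Z %| F.@[chart_pt i k u (v : nat)%:Z])%Z &&
     ~~ (p%:Z %| (F^`M(k)).@[chart_pt i k u (v : nat)%:Z])%Z]| <= d)%N.
Proof.
move=> pp ki hF; set A := [set _ | _].
pose f := [the {rmorphism int -> 'F_p} of intr].
pose h (G : {mpoly int[3]}) := mmap (polyC \o f) (chart_pt i k (f u)%:P 'X) G.
have hE G (v : int) : (h G).[f v] = f (G.@[chart_pt i k u v]).
  rewrite -[LHS]/(horner_eval (f v) _) /h rmorph_mmap /meval rmorph_mmap.
  apply: eq_bigr => m _; rewrite /= /horner_eval hornerC; congr (_ * _).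
  apply: eq_bigr => j _ /=; congr (_ ^+ _); rewrite /chart_pt; case: ifP => _.
    by rewrite hornerC rmorph1.
  by case: ifP => _; rewrite !(hornerX, hornerC).
have dvdE (z : int) : (p%:Z %| z)%Z = (f z == 0) by rewrite (dvdz_pcharf (pchar_Fp pp)).
have dh : (h F)^`() = h F^`M(k).
  apply: deriv_mmap; first by rewrite /chart_pt (negbTE ki) eqxx.
  by move=> j jk; rewrite /chart_pt (negbTE jk); case: ifP => _; [exists 1|exists (f u)].
have [->|[v0 v0A]] := set_0Vmem A; first by rewrite cards0.
have h0 : h F != 0.
  move: v0A; rewrite inE => /andP[_]; apply: contraNneq => hF0.
  by rewrite dvdE -hE -dh hF0 deriv0 horner0.
have sz : (size (h F) <= d.+1)%N.
  apply: size_mmap_leq => // j; rewrite /chart_pt; case: ifP => _; first by rewrite size_polyC oner_eq0.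
  by case: ifP => _; rewrite ?size_polyX // (leq_trans (size_polyC_leq1 _)).
rewrite -ltnS; apply: leq_trans sz; rewrite cardE.
rewrite -(size_map (fun v : 'I_p => f (v : nat)%:Z)); apply: max_poly_roots => //.
  apply/allP => _ /mapP[v vA ->]; move: vA; rewrite mem_enum inE => /andP[+ _].
  by rewrite dvdE /root hE.
rewrite map_inj_uniq ?enum_uniq // => v w /eqP.
rewrite -subr_eq0 -rmorphB -dvdE -eqz_mod_dvd !modz_small ?ltz_nat ?ltn_ord //.
by move=> /eqP [] /val_inj.
Qed.

Lemma cover_count (T C : eqType) (s : seq T) (cs : seq C) (r : C -> pred T) (M : nat) :
  {in s, forall x, exists2 c, c \in cs & r c x} ->
  {in cs, forall c, count (r c) s <= M}%N -> (size s <= size cs * M)%N.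
Proof.
move=> cover bound; apply: (@leq_trans (\sum_(c <- cs) count (r c) s)); last first.
  rewrite -sum1_size big_distrl /= big_seq [X in (_ <= X)%N]big_seq.
  by apply: leq_sum => c cc; rewrite mul1n bound.
under eq_bigr do rewrite -sum1_count big_mkcond.
rewrite exchange_big /= -sum1_size big_seq [X in (_ <= X)%N]big_seq.
apply: leq_sum => x /cover [c cc rcx].
by rewrite (big_rem c cc) rcx.
Qed.

Lemma class_count (R : realType) (B : 'I_3 -> R) (F : {mpoly int[3]}) (d n p : nat)
    (m : 'X_{1..3}) (i k : 'I_3) (u0 v0 : int) (S : seq {ffun 'I_3 -> int}) :
  (forall l, 1 <= B l) -> mirreducible (toC F) -> F \is d.-homog -> prime p -> k != i ->
  (p%:Z %| F.@[chart_pt i k u0 v0])%Z -> ~~ (p%:Z %| (F^`M(k)).@[chart_pt i k u0 v0])%Z ->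
  m \in msupp F -> (forall m', m' \in msupp F ->
    weight B m' < weight B m \/ weight B m' = weight B m /\ (m' <= m)%O) ->
  (0 < size (aux_monomials n m))%N ->
  (size (aux_monomials n m)).+1%:R ^+ size (aux_monomials n m) *
    \prod_(e <- aux_monomials n m) weight B e <= p%:R ^+ 'C(size (aux_monomials n m), 2) ->
  uniq S -> {in S, forall x : {ffun 'I_3 -> int}, [/\ Z3 x, F.@[x] = 0,
    forall l, `|(x l)%:~R| <= B l, ~~ (p%:Z %| x i)%Z &
    forall j, (p%:Z %| x j - x i * chart_pt i k u0 v0 j)%Z]} ->
  (size S <= d * (d + n))%N.
Proof.
move=> B1 Firr hF pp ki F0 dF mF mP s0 big_p uS SP.
have [G [G0 hG Gaux Gx]] := class_form B1 hF pp ki F0 dF s0 big_p.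
have dm : mdeg m = d by move/dhomogP: hF => /(_ m mF).
apply: (bezout (F := toC F) (G := toC G)) uS _; rewrite ?toC_homog -?dm //.
  by rewrite dm.
  move=> FG; have [|||e] := max_monomial_dvd B1 (m := m) _ _ _ FG.
  - by rewrite msupp_toC.
  - by move=> m'; rewrite msupp_toC; apply: mP.
  - by rewrite toC_eq0.
  by rewrite msupp_toC => /Gaux; rewrite mem_filter => /andP[/negbTE ->].
move=> x /SP [xZ Fx xB xi xj]; split; rewrite // meval_toC ?Fx //.
by rewrite Gx.
Qed.

Lemma chart_exists (F : {mpoly int[3]}) d p (x : {ffun 'I_3 -> int}) (k0 : 'I_3) :
  prime p -> F \is d.-homog -> Z3 x -> F.@[x] = 0 -> ~~ (p%:Z %| (F^`M(k0)).@[x])%Z ->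
  exists i k, [/\ k != i, ~~ (p%:Z %| x i)%Z & ~~ (p%:Z %| (F^`M(k)).@[x])%Z].
Proof.
move=> pp hF xZ Fx dF.
have pM (a b : int) : (p%:Z %| a * b)%Z = (p%:Z %| a)%Z || (p%:Z %| b)%Z.
  by rewrite !dvdzE abszM Euclid_dvdM.
have [i xi] : exists i, ~~ (p%:Z %| x i)%Z.
  apply: contrapT => H; have: (p%:Z %| \big[gcdz/0]_(i < 3) x i)%Z.
    elim/big_rec: _ => [|i g _ pg]; first exact: dvdz0.
    rewrite dvdz_gcd pg andbT; apply/negPn/negP => xi; apply: H; by exists i.
  by case: xZ => _ -> _; rewrite dvdz1 /= => /eqP p1; move: pp; rewrite p1.
(* If i = k0 were the only choice on both sides, Euler's identity would make p divide
   x_i times the derivative. *)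
have [ki|ki] := eqVneq k0 i; last by exists i, k0.
have [[j /andP[jk xj]]|H] := EM (exists j, (j != k0) && ~~ (p%:Z %| x j)%Z).
  by exists j, k0; rewrite eq_sym.
have := euler_eval x hF; rewrite Fx mul0rn (bigD1 k0) //= => eul.
have : (p%:Z %| x k0 * (F^`M(k0)).@[x])%Z.
  rewrite -[X in (_ %| X)%Z](addrK (\sum_(j | j != k0) x j * (F^`M(j)).@[x])) eul sub0r.
  rewrite rpredN rpred_sum // => j jk; rewrite dvdz_mulr //.
  by apply/negPn/negP => xj; apply: H; exists j; rewrite jk.
by rewrite pM (negbTE dF) orbF ki (negbTE xi).
Qed.

Lemma prime_count (R : realType) (B : 'I_3 -> R) (F : {mpoly int[3]}) (d n p : nat)
    (m : 'X_{1..3}) (S : seq {ffun 'I_3 -> int}) :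
  (forall l, 1 <= B l) -> mirreducible (toC F) -> F \is d.-homog -> prime p ->
  m \in msupp F -> (forall m', m' \in msupp F ->
    weight B m' < weight B m \/ weight B m' = weight B m /\ (m' <= m)%O) ->
  (0 < size (aux_monomials n m))%N ->
  (size (aux_monomials n m)).+1%:R ^+ size (aux_monomials n m) *
    \prod_(e <- aux_monomials n m) weight B e <= p%:R ^+ 'C(size (aux_monomials n m), 2) ->
  uniq S -> {in S, forall x : {ffun 'I_3 -> int}, [/\ Z3 x, F.@[x] = 0,
    forall l, `|(x l)%:~R| <= B l & exists k, ~~ (p%:Z %| (F^`M(k)).@[x])%Z]} ->
  (size S <= 9 * (p * d) * (d * (d + n)))%N.
Proof.
move=> B1 Firr hF pp mF mP s0 big_p uS SP.
pose C := ('I_3 * 'I_3 * 'I_p * 'I_p)%type.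
pose good (c : C) := let: (i, k, u, v) := c in [&& k != i,
  (p%:Z %| F.@[chart_pt i k (u : nat)%:Z (v : nat)%:Z])%Z &
  ~~ (p%:Z %| (F^`M(k)).@[chart_pt i k (u : nat)%:Z (v : nat)%:Z])%Z].
pose r (c : C) (x : {ffun 'I_3 -> int}) := let: (i, k, u, v) := c in
  ~~ (p%:Z %| x i)%Z && [forall j, (p%:Z %| x j - x i * chart_pt i k (u : nat)%:Z (v : nat)%:Z j)%Z].
have card_good : (#|[set c | good c]| <= 9 * (p * d))%N.
  rewrite -sum1_card (eq_bigl (fun c : C => xpredT c.1 && good (c.1, c.2))); last first.
    by move=> [a v]; rewrite inE.
  rewrite -(pair_big_dep xpredT (fun a v => good (a, v)) (fun _ _ => 1%N)) /=.
  apply: (@leq_trans (\sum_(a : 'I_3 * 'I_3 * 'I_p) d)).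
    apply: leq_sum => -[[i k] u] _; rewrite sum1_card.
    have [ki|ki] := eqVneq k i.
      by rewrite eq_card0 // => v; rewrite unfold_in /= ki eqxx.
    have := residue_roots (u : nat)%:Z pp ki hF; apply: leq_trans.
    by apply/eq_leq/eq_card => v; rewrite [RHS]inE [LHS]unfold_in.
  by rewrite sum_nat_const !card_prod !card_ord mulnA.
apply: leq_trans (_ : size (enum [set c | good c]) * (d * (d + n)) <= _)%N; last first.
  by rewrite leq_mul2r -cardE card_good orbT.
apply: (cover_count (r := r)) => [x xS|c].
  have [xZ Fx xB [k0 dk0]] := SP x xS.
  have [i [k [ki xi dk]]] := chart_exists pp hF xZ Fx dk0.
  have copx : coprimez (x i) p%:Z.
    by move: xi; rewrite /dvdz /coprimez /gcdz /= -prime_coprime // coprime_sym /coprime => /eqP ->.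
  have /coprimezP[[w b] /= wb] := copx.
  have wx : (p%:Z %| 1 - w * x i)%Z by rewrite -wb addrC addKr dvdz_mull.
  have [j [ji jk]] : exists j : 'I_3, j != i /\ j != k.
    by case: i k {xi dk copx wb wx} ki => [[|[|[|?]]] ?] [[|[|[|?]]] ?] //= _;
      solve [by exists 0 | by exists 1 | by exists (inord 2); rewrite -!val_eqE /= inordK].
  have l3 l : [|| l == i, l == k | l == j].
    case: i k j l {xi dk copx wb wx} ki ji jk =>
      [[|[|[|?]]] ?] [[|[|[|?]]] ?] [[|[|[|?]]] ?] [[|[|[|?]]] ?] //=.
  have ltp z : (`|(z %% p)%Z|%N < p)%N.
    by rewrite -ltz_nat gez0_abs ?modz_ge0 ?ltz_pmod ?ltz_nat ?prime_gt0 // -lt0n prime_gt0.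
  pose res z : 'I_p := Ordinal (ltp z).
  have resE z : (p%:Z %| z - (res z : nat)%:Z)%Z.
    rewrite /= gez0_abs ?modz_ge0 // ?pnatr_eq0 -?lt0n ?prime_gt0 // -eqz_mod_dvd modz_mod //.
  have xE l : (p%:Z %| x l - x i * chart_pt i k (res (w * x j) : nat)%:Z (res (w * x k) : nat)%:Z l)%Z.
    have red z : x l - x i * z = (1 - w * x i) * x l + x i * (w * x l - z) by ring.
    rewrite red; apply: rpredD; first exact: dvdz_mulr.
    apply: dvdz_mull.
    case/or3P: (l3 l) => /eqP ->; rewrite /chart_pt ?eqxx ?(negbTE ki) ?(negbTE ji) ?(negbTE jk) ?resE //.
    by rewrite -opprB rpredN.
  exists (i, k, res (w * x j), res (w * x k)); last by rewrite /= xi; apply/forallP.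
  have pM (a c : int) : (p%:Z %| a * c)%Z = (p%:Z %| a)%Z || (p%:Z %| c)%Z.
    by rewrite !dvdzE abszM Euclid_dvdM.
  have pX (a : int) e : (p%:Z %| a)%Z = false -> (p%:Z %| a ^+ e)%Z = false.
    by move=> pa; elim: e => [|e IH]; rewrite ?exprS ?pM ?pa ?IH // expr0 dvdz1 gtn_eqF // prime_gt1.
  have transfer e (G : {mpoly int[3]}) : G \is e.-homog ->
      (p%:Z %| G.@[x])%Z = (p%:Z %| G.@[chart_pt i k (res (w * x j) : nat)%:Z (res (w * x k) : nat)%:Z])%Z.
    move=> hG; have := dvdz_meval G xE; rewrite (meval_homog _ _ hG) => dG.
    set y := chart_pt _ _ _ _ in dG *.
    have -> : (p%:Z %| G.@[x])%Z = (p%:Z %| x i ^+ e * G.@[y])%Z.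
      apply/idP/idP => H; last by rewrite -[X in (_ %| X)%Z](subrK (x i ^+ e * G.@[y])) rpredD.
      by rewrite -[X in (_ %| X)%Z](subKr G.@[x]) rpredB.
    by rewrite pM pX // (negbTE xi).
  rewrite mem_enum inE /= ki -(transfer _ _ hF) Fx dvdz0 -(transfer _ _ (deriv_homog k hF)).
  by rewrite dk.
rewrite mem_enum inE /good; case: c => [[[i k] u] v] /= /and3P[ki F0 dF].
rewrite -size_filter.
apply: (class_count (B := B) (i := i) (k := k) (u0 := (u : nat)%:Z) (v0 := (v : nat)%:Z)
  B1 Firr hF pp ki F0 dF mF mP s0 big_p).
  exact: filter_uniq.
move=> x; rewrite mem_filter => /andP[/andP[xi /forallP xj] /SP[xZ Fx xB _]].
by split.
Qed.

(** * Primes in short ranges *)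

Lemma central_binomial_lower n : (2 ^ n <= 'C(n.*2, n))%N.
Proof.
elim: n => // n IH; rewrite expnS mul2n doubleS binS.
have -> : 'C(n.*2.+1, n.+1) = 'C(n.*2.+1, n).
  by rewrite -[RHS]bin_sub; [congr 'C(_, _); lia | lia].
rewrite addnn leq_double; apply: leq_trans IH _.
by case: (n) => [|m]; rewrite ?bin0 // binS leq_addr.
Qed.

Lemma logn_fact_extend p n K : prime p -> (n < K)%N ->
  logn p n`! = (\sum_(1 <= k < K) n %/ p ^ k)%N.
Proof.
move=> pp nK; rewrite logn_fact // [RHS](big_cat_nat _ (n := n.+1)) //=.
have -> : (\sum_(n.+1 <= k < K) n %/ p ^ k = 0)%N; last by rewrite addn0.
  rewrite big_nat_cond; apply: big1 => k /andP[/andP[nk _] _].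
  by rewrite divn_small //; apply: leq_trans (ltnW (ltn_expl _ (prime_gt1 pp))).
Qed.

Lemma logn_central_binomial p n : prime p -> (0 < n)%N ->
  (p ^ logn p 'C(n.*2, n) <= n.*2)%N.
Proof.
move=> pp n0; have n20 : (0 < n.*2)%N by rewrite double_gt0.
apply: leq_trans (trunc_logP (prime_gt1 pp) n20).
rewrite leq_exp2l ?prime_gt1 //; set L := trunc_log p _.
have := congr1 (logn p) (bin_fact (leq_addr n n)).
rewrite addnK addnn !lognM ?muln_gt0 ?fact_gt0 ?bin_gt0 -?addnn ?leq_addr // addnn.
rewrite !(logn_fact_extend (K := n.*2.+1) pp); try lia.
have : (\sum_(1 <= k < n.*2.+1) n.*2 %/ p ^ k <=
  \sum_(1 <= k < n.*2.+1) ((n %/ p ^ k).*2 + (k <= L)))%N.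
  apply: leq_sum => k _; have pk : (0 < p ^ k)%N by rewrite expn_gt0 prime_gt0.
  have [kL|kL] := leqP k L.
    rewrite addn1 -ltnS ltn_divLR // mulnC.
    have := ltn_ceil n pk; nia.
  rewrite divn_small //.
  apply: leq_trans (trunc_log_ltn _ (prime_gt1 pp)) _.
  by rewrite leq_exp2l ?prime_gt1.
rewrite big_split /= -!addnn.
have -> : (\sum_(1 <= k < (n + n).+1) (n %/ p ^ k).*2 =
   \sum_(1 <= k < (n + n).+1) n %/ p ^ k + \sum_(1 <= k < (n + n).+1) n %/ p ^ k)%N.
  by rewrite -big_split /=; apply: eq_bigr => k _; rewrite addnn.
have -> : (\sum_(1 <= k < (n + n).+1) (k <= L) = minn (n + n) L)%N.
  elim: (n + n)%N => [|K IH]; first by rewrite big_geq // min0n.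
  by rewrite big_nat_recr //= IH; case: (ltnP K L) => /= ?; lia.
lia.
Qed.

Lemma central_binomial_upper n : (0 < n)%N ->
  ('C(n.*2, n) <= n.*2 ^ size (primes 'C(n.*2, n)))%N.
Proof.
move=> n0; have C0 : (0 < 'C(n.*2, n))%N by rewrite bin_gt0 -addnn leq_addr.
rewrite {1}(prod_prime_decomp C0) prime_decompE big_map /=.
have : {in primes 'C(n.*2, n), forall p, p ^ logn p 'C(n.*2, n) <= n.*2}%N.
  by move=> p; rewrite mem_primes => /and3P[pp _ _]; apply: logn_central_binomial.
elim: (primes _) => [|p ps IH] Hps; first by rewrite big_nil.
rewrite big_cons expnS leq_mul ?Hps ?mem_head // IH // => q qps.
by rewrite Hps // in_cons qps orbT.
Qed.

Lemma many_primes r A t : (0 < A)%N -> (A < 2 ^ t)%N -> (r <= A)%N ->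
  exists ps : seq nat, [/\ size ps = r, uniq ps & {in ps, forall p,
    [/\ prime p, (A - r < p)%N & (p <= (A * (t.*2 + 6)).*2)%N]}].
Proof.
move=> A0 At rA; set n := (A * (t.*2 + 6))%N.
have n0 : (0 < n)%N by rewrite muln_gt0 A0 addn_gt0 orbT.
set ps := [seq p <- primes 'C(n.*2, n) | (A - r < p)%N].
have psP : {in ps, forall p, [/\ prime p, (A - r < p)%N & (p <= n.*2)%N]}.
  move=> p; rewrite mem_filter mem_primes => /andP[Ap /and3P[pp C0 pC]]; split=> //.
  apply: leq_trans (logn_central_binomial pp n0).
  by rewrite -{1}(expn1 p) leq_exp2l ?prime_gt1 // -pfactor_dvdn // expn1.
have sz : (r <= size ps)%N.
  rewrite leqNgt; apply/negP => szr.
  have small : (size (primes 'C(n.*2, n)) <= A)%N.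
    rewrite -(count_predC (fun p => A - r < p)%N) -size_filter -/ps.
    apply: (@leq_trans (size ps + (A - r))); last by move: szr rA; lia.
    rewrite leq_add2l -size_filter -[X in (_ <= X)%N](size_iota 1 (A - r)); apply: uniq_leq_size.
      by rewrite filter_uniq // primes_uniq.
    move=> p; rewrite mem_filter mem_primes mem_iota /= => /andP[Ap /and3P[pp _ _]].
    by rewrite prime_gt0 //= add1n ltnS leqNgt.
  have := leq_trans (central_binomial_lower n) (central_binomial_upper n0).
  apply/negP; rewrite -ltnNge.
  have n21 : (0 < n.*2)%N by rewrite double_gt0.
  apply: leq_ltn_trans (_ : _ <= n.*2 ^ A)%N _; first by rewrite leq_pexp2l.
  rewrite [X in (_ < 2 ^ X)%N]mulnC expnM ltn_exp2r //.
  have key : (t.*2 + 6 < 2 ^ (t + 5))%N.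
    elim: (t) => // u IH; rewrite addSn expnS; move: IH; rewrite doubleS; lia.
  rewrite (_ : t.*2 + 6 = t + (t + 5).+1)%N; last by lia.
  rewrite expnD expnS /n; move: At key; set a := (2 ^ t)%N; set b := (2 ^ _)%N; nia.
exists (take r ps); split; first by rewrite size_takel.
  by rewrite take_uniq // filter_uniq // primes_uniq.
by move=> p /mem_take /psP.
Qed.

Lemma bernoulli_ineq (R : realType) (c : R) l : 1 <= c -> 1 + l%:R * (c - 1) <= c ^+ l.
Proof.
move=> c1; elim: l => [|l IH]; first by rewrite mul0r addr0.
rewrite exprS; apply: le_trans (_ : c * (1 + l%:R * (c - 1)) <= _).
  rewrite -subr_ge0 -natr1 [X in 0 <= X](_ : _ = l%:R * (c - 1) ^+ 2); last by ring.
  by rewrite mulr_ge0 // sqr_ge0.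
by rewrite ler_pM2l // (lt_le_trans ltr01).
Qed.

Lemma primes_in_range (R : realType) (r : nat) (delta : R) : 0 < delta ->
  exists2 C : R, 0 < C & forall x, 1 <= x -> exists ps : seq nat,
    [/\ size ps = r, uniq ps & {in ps, forall p : nat,
    [/\ prime p, x <= p%:R & p%:R <= C * x `^ (1 + delta)]}].
Proof.
move=> d0; pose c : R := 2 `^ delta.
have c1 : 1 < c.
  have := gt0_ltr_powR d0 (x := 1) (y := 2); rewrite !nnegrE powR1; apply => //.
  by rewrite ltr1n.
pose K : R := 4 + (c - 1)^-1; have K0 : 0 < K by rewrite addr_gt0 ?invr_gt0 ?subr_gt0.
have r0 : 0 < (1 + r)%:R :> R by rewrite ltr0n.
exists (4 * (1 + r)%:R * (K * (1 + r)%:R `^ delta)).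
  by rewrite !mulr_gt0 ?powR_gt0.
move=> x x1; have x0 : 0 < x by apply: lt_le_trans x1.
have /andP[Qx xQ] := truncn_itv (ltW x0); set Q := Num.truncn x in Qx xQ.
have Q0 : (0 < Q)%N by rewrite -ltnS -(ltr_nat R) (le_lt_trans x1 xQ).
pose A := (Q + r)%N; have A0 : (0 < A)%N by rewrite addn_gt0 Q0.
pose l := trunc_log 2 A.
have /andP[lA Al] := trunc_log_bounds (isT : (1 < 2)%N) A0; rewrite -/l in lA Al.
have [ps [sz ups psP]] := many_primes A0 Al (leq_addl Q r).
exists ps; split=> // p /psP [pp]; rewrite addnK => Qp pA; split=> //.
  by apply: le_trans (ltW xQ) _; rewrite ler_nat.
have Ax : A%:R <= x * (1 + r)%:R.
  rewrite /A !natrD mulrDr mulr1 lerD // -[X in X <= _]mul1r ler_pM //.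
have lK : l%:R + 4 <= K * c ^+ l.
  apply: le_trans (_ : K * (1 + l%:R * (c - 1)) <= _); last first.
    by rewrite ler_pM2l // bernoulli_ineq // ltW.
  have -> : K * (1 + l%:R * (c - 1)) = l%:R + 4 + ((c - 1)^-1 + 4 * (l%:R * (c - 1))).
    rewrite /K; field; by rewrite subr_eq0 gt_eqF.
  by rewrite lerDl addr_ge0 ?invr_ge0 ?mulr_ge0 ?subr_ge0 // ltW.
have cl : c ^+ l <= x `^ delta * (1 + r)%:R `^ delta.
  rewrite -powRM ?(ltW x0) // -powR_mulrn ?powR_ge0 // powRAC powR_mulrn //.
  apply: ge0_ler_powR; rewrite ?nnegrE ?exprn_ge0 ?mulr_ge0 ?(ltW x0) ?(ltW d0) //.
  by apply: le_trans Ax; rewrite -natrX ler_nat.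
have pA' : p%:R <= 4 * A%:R * (l%:R + 4) :> R.
  rewrite -natrD -!natrM ler_nat; apply: leq_trans pA _; lia.
apply: le_trans pA' _; rewrite powRD ?powRr1 ?(ltW x0) //; last by rewrite (gt_eqF x0) implybT.
apply: le_trans (_ : 4 * (x * (1 + r)%:R) * (K * (x `^ delta * (1 + r)%:R `^ delta)) <= _).
  rewrite -!mulrA ler_pM2l // mulrA ler_pM ?addr_ge0 //.
  by apply: le_trans lK _; rewrite ler_pM2l.
by rewrite le_eqVlt; apply/orP; left; apply/eqP; ring.
Qed.

(** * Exponents *)

Lemma bin3_six k : ('C(k.+2, 3) * 6 = k.+2 * k.+1 * k)%N.
Proof.
elim: k => // k IH; rewrite binS mulnDl IH; have /= b2 := bin2_double k.+2.
rewrite (_ : 6 = 2 * 3)%N // mulnA b2; ring.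
Qed.

Lemma aux_exponents d n m : (0 < d)%N -> mdeg m = d ->
  let s := size (aux_monomials n m) in
  [/\ (1 < s)%N, (d ^ 2 * 'C(n.+2, 2) <= 'C(s, 2))%N,
      (d ^ 2 * (n.+2 * n.+1) <= 2 * 'C(s, 2))%N &
      (2 * 'C((d + n).+2, 3) <= 2 * 'C(n.+2, 3) + 2 * (d * 'C(n.+2, 2)) + d ^ 2 * (2 * n + 3 + d))%N].
Proof.
move=> d0 dm s; have := size_aux_monomials n m; rewrite dm -/s => sE.
have /= h1 := bin2_double n.+2; have /= h2 := bin2_double (d + n).+2.
have h3 := bin2_double s; have h4 := bin3_six n; have h5 := bin3_six (d + n)%N.
(* All four estimates follow from s = d (2 n + d + 3) / 2. *)
have sE2 : (s * 2 = d * (2 * n + d + 3))%N.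
  by move: sE h1 h2; move: 'C(_, _) 'C(_, _) => b1 b2; clear=> ? ? ?; nia.
have s_ge : (d * n.+2 <= s)%N.
  rewrite -(leq_pmul2r (m := 2)) // sE2 -mulnA leq_mul2l; apply/orP; right; lia.
have s_pred : (d * n.+1 <= s.-1)%N.
  rewrite -ltnS prednK; last by apply: leq_trans s_ge; rewrite muln_gt0 d0.
  by apply: leq_trans s_ge; rewrite ltn_mul2l d0 /=.
have S2_ge : (d ^ 2 * (n.+2 * n.+1) <= 2 * 'C(s, 2))%N.
  rewrite [X in (_ <= X)%N]mulnC h3; apply: leq_trans (leq_mul s_ge s_pred).
  by apply: eq_leq; ring.
split=> //.
- by apply: leq_trans s_ge; apply: (@leq_trans (1 * n.+2)) => //; rewrite leq_mul2r d0 orbT.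
- by rewrite -(leq_pmul2r (m := 2)) // -mulnA h1 [X in (_ <= X)%N]mulnC.
rewrite -(leq_pmul2r (m := 3)) //.
have -> : (2 * 'C((d + n).+2, 3) * 3 = 'C((d + n).+2, 3) * 6)%N by ring.
have -> : ((2 * 'C(n.+2, 3) + 2 * (d * 'C(n.+2, 2)) + d ^ 2 * (2 * n + 3 + d)) * 3 =
  'C(n.+2, 3) * 6 + 3 * d * ('C(n.+2, 2) * 2) + 3 * (d ^ 2 * (2 * n + 3 + d)))%N by ring.
rewrite h5 h4 h1 -subn_eq0; apply/eqP.
have [k ->] : exists k, (n.+2 * n.+1 * n + 3 * d * (n.+2 * n.+1) + 3 * (d ^ 2 * (2 * n + 3 + d)) =
  (d + n).+2 * (d + n).+1 * (d + n) + k)%N.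
  exists (3 * d * n + 4 * d + 6 * d ^ 2 + 2 * d ^ 3 + 3 * n * d ^ 2)%N; ring.
by rewrite subnDA subnn sub0n.
Qed.

Lemma aux_size_bound (R : realType) (B : 'I_3 -> R) d n m (eta : R)
    (S2 := 'C(size (aux_monomials n m), 2)) :
  (forall l, 1 <= B l) -> (0 < d)%N -> mdeg m = d -> 0 < eta ->
  (3 + d)%:R <= eta * n.+2%:R ->
  \prod_(e <- aux_monomials n m) weight B e <=
  ((\prod_l B l) `^ (d%:R^-1 + eta) * weight B m `^ (- d%:R ^- 2)) ^+ S2.
Proof.
move=> B1 d0 dm eta0 eta_n; set V := \prod_l B l.
have V1 : 1 <= V by rewrite /V; elim/big_rec: _ => // l v _ v1; rewrite mulr_ege1.
have V0 : 0 < V by apply: lt_le_trans V1.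
have T0 := weight_gt0 m B1.
have TV : weight B m <= V ^+ d.
  rewrite /weight /V -prodrXl; apply: ler_prod => l _.
  have B0 := lt_le_trans ltr01 (B1 l).
  rewrite exprn_ge0 ?(ltW B0) //= ler_weXn2l // -dm mdegE (bigD1 l) //= leq_addr //.
have P0 : 0 < \prod_(e <- aux_monomials n m) weight B e.
  by rewrite prodr_gt0 // => e _; apply: weight_gt0.
have := congr1 (@ln R) (prod_aux_monomials B n m); rewrite -/V dm.
rewrite !lnM ?posrE ?mulr_gt0 ?exprn_gt0 // !lnXn //.
have T0' := powR_gt0 (- d%:R ^- 2) T0; have V0' := powR_gt0 (d%:R^-1 + eta) V0.
rewrite -ler_ln ?posrE ?exprn_gt0 ?mulr_gt0 // lnXn ?mulr_gt0 // lnM ?posrE // !ln_powR.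
have tv : ln (weight B m) <= d%:R * ln V.
  by rewrite mulr_natl -lnXn // ler_ln ?posrE ?exprn_gt0.
have v0 : 0 <= ln V by apply: ln_ge0.
have [_ dS S_ge bS] := aux_exponents n d0 dm; rewrite -/S2 in dS S_ge.
move: (ln (weight B m)) (ln V) tv v0 => t v tv v0.
move: (ln _) S2 dS S_ge bS => L S2.
move: 'C((d + n).+2, 3) 'C(n.+2, 3) 'C(n.+2, 2) => cn' cn bn dS S_ge bS.
rewrite -[t *+ _]mulr_natr -[v *+ _]mulr_natr -[X in _ = X]mulr_natr => LE.
rewrite -[X in _ <= X]mulr_natr.
rewrite -(ler_nat R) !(natrM, natrD, natrX) in dS.
rewrite -(ler_nat R) !(natrM, natrD, natrX) in S_ge.
rewrite -(ler_nat R) !(natrM, natrD, natrX) in bS.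
rewrite !natrD in eta_n.
move: dS S_ge bS LE; set b := bn%:R; set c := cn%:R; set c' := cn'%:R.
set q := S2%:R => dS S_ge bS LE.
have dR : 0 < d%:R :> R by rewrite ltr0n.
have -> : L = c' * v - c * v - b * t by lra.
(* Both sides are compared along b (d v - t) with t <= d v, where w = q / d^2 exceeds b. *)
pose w := q / d%:R ^+ 2; have qE : q = w * d%:R ^+ 2 by rewrite /w divfK // expf_neq0 ?gt_eqF.
have wb : b <= w by rewrite /w ler_pdivlMr ?exprn_gt0 // mulrC.
have wn : n.+2%:R * n.+1%:R <= 2 * w.
  by rewrite /w mulrA ler_pdivlMr ?exprn_gt0 // mulrC.
have -> : ((d%:R^-1 + eta) * v + - d%:R ^- 2 * t) * q =
    w * (d%:R * v - t) + w * d%:R ^+ 2 * eta * v.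
  by rewrite qE; field; rewrite gt_eqF.
apply: le_trans (_ : b * (d%:R * v - t) + (d%:R ^+ 2 * (2 * n%:R + 3 + d%:R)) / 2 * v <= _).
  have : (2 * c' - 2 * c - 2 * (d%:R * b)) * v <= (d%:R ^+ 2 * (2 * n%:R + 3 + d%:R)) * v.
    by rewrite ler_wpM2r //; lra.
  lra.
apply: lerD; first by rewrite ler_wpM2r // subr_ge0.
rewrite ler_wpM2r //.
have key : 2 * n%:R + 3 + d%:R <= 2 * (w * eta).
  rewrite -[n.+2]addn2 -[n.+1]addn1 !natrD in wn eta_n.
  have n0 : 0 <= n%:R :> R by [].
  have h1 : (n%:R + 1) * (3 + d%:R) <= (n%:R + 1) * (eta * (n%:R + 2)) :> R.
    by rewrite ler_wpM2l // addr_ge0.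
  have h2 : eta * ((n%:R + 2) * (n%:R + 1)) <= eta * (2 * w) by rewrite ler_pM2l.
  have h3 : 0 <= n%:R * d%:R :> R by rewrite mulr_ge0.
  lra.
have := ler_wpM2l (exprn_ge0 2 (ltW dR)) key; lra.
Qed.

(** * Integral models with bounded coefficients *)

Lemma monomial_enum d : exists e : 'I_('C(d.+2, 2)) -> 'X_{1..3},
  [/\ injective e, forall j, mdeg (e j) = d & forall m, mdeg m = d -> exists j, m = e j].
Proof.
have sE := size_monomials d.
have ltE (j : 'I_('C(d.+2, 2))) : (j < size (monomials d))%N by rewrite sE.
exists (fun j => nth 0%MM (monomials d) j); split=> [j l jl|j|m /eqP].
- by apply/val_inj/eqP; rewrite -(nth_uniq 0%MM (ltE j) (ltE l) (monomials_uniq _)) jl.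
- by apply/eqP; rewrite -mem_monomials mem_nth.
rewrite -mem_monomials => mE; have := mE; rewrite -index_mem sE => lt_m.
by exists (Ordinal lt_m); rewrite /= nth_index.
Qed.

Lemma meval_homog_enum (R : comNzRingType) d N (e : 'I_N -> 'X_{1..3}) (F : {mpoly R[3]})
    (x : 'I_3 -> R) :
  injective e -> (forall m, mdeg m = d -> exists j, m = e j) -> F \is d.-homog ->
  F.@[x] = \sum_j F@_(e j) * \prod_l x l ^+ e j l.
Proof.
move=> e_inj eS hF; have {1}-> : F = \sum_j F@_(e j) *: 'X_[e j].
  apply/mpolyP => m; rewrite raddf_sum /=.
  have [/eS [j ->]|md] := eqVneq (mdeg m) d.
    rewrite (bigD1 j) //= mcoeffZ mcoeffX eqxx mulr1 big1 ?addr0 // => l lj.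
    by rewrite mcoeffZ mcoeffX (inj_eq e_inj) (negbTE lj) mulr0.
  rewrite (dhomog_nemf_coeff hF md) big1 // => j _; rewrite mcoeffZ mcoeffX.
  case: eqP => [ejm|]; last by rewrite mulr0.
  by rewrite (dhomog_nemf_coeff hF) ?mul0r //= ejm.
by rewrite raddf_sum /=; apply: eq_bigr => j _; rewrite mevalZ mevalX.
Qed.

Lemma integral_vanishing_form (F : {mpoly algC[3]}) d M (S : seq {ffun 'I_3 -> int})
    (N := 'C(d.+2, 2)) :
  F != 0 -> F \is d.-homog -> (0 < M)%N ->
  {in S, forall x : {ffun 'I_3 -> int},
     F.@[fun i => (x i)%:~R] = 0 /\ forall l, (`|x l| <= M)%N} ->
  exists G : {mpoly int[3]}, [/\ G != 0, G \is d.-homog,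
    {in S, forall x : {ffun 'I_3 -> int}, G.@[x] = 0} &
    forall m, (`|G@_m| <= (2 * N * M ^ d) ^ N)%N].
Proof.
move=> F0 hF M0 SP; have [e [e_inj eD eS]] := monomial_enum d; rewrite -/N in e e_inj eD eS.
pose pts i : {ffun 'I_3 -> int} := tnth (in_tuple S) i.
pose mon (x : {ffun 'I_3 -> int}) j : int := \prod_l x l ^+ e j l.
pose A : 'M[algC]_(size S, N) := \matrix_(i, j) (mon (pts i) j)%:~R.
pose c : 'cV[algC]_N := \col_j F@_(e j).
have Ac : A *m c = 0.
  apply/colP => i; rewrite !mxE; have [Fx _] := SP _ (mem_tnth i (in_tuple S)).
  rewrite -[RHS]Fx (meval_homog_enum _ e_inj eS hF); apply: eq_bigr => j _.
  rewrite !mxE mulrC rmorph_prod; congr (_ * _).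
  by apply: eq_bigr => l _; rewrite rmorphXn.
have c0 : c != 0.
  apply: contraNneq F0 => c0; apply/eqP/mpolyP => m; rewrite mcoeff0.
  have [/eS [j ->]|md] := eqVneq (mdeg m) d.
    by have /colP/(_ j) := c0; rewrite !mxE.
  by apply: (dhomog_nemf_coeff hF).
have rkA : (\rank A < N)%N.
  rewrite ltn_neqAle rank_leq_col andbT; apply: contraNneq c0 => rA.
  have full : row_full A by apply/eqP.
  by apply/eqP/(row_full_inj full); rewrite Ac mulmx0.
set a := (2 * N * M ^ d)%N; set K := (a ^ N)%N.
pose Mo := (N * K * M ^ d).+1.
have N0 : (0 < N)%N by apply: leq_trans rkA.
have a0 : (0 < a)%N by rewrite /a !muln_gt0 N0 expn_gt0 M0.
have lt_mod : (\prod_(i < \rank A) Mo < \prod_(j < N) K.+1)%N.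
  rewrite !prod_nat_const !card_ord.
  apply: (@leq_ltn_trans ((a * K.+1) ^ \rank A)).
    have leX x y k : (x <= y -> x ^ k <= y ^ k)%N by case: k => // k; rewrite leq_exp2r.
    apply: leX; rewrite /Mo /K mulnAC [in X in (_ <= X)%N]/a -mulnA.
    have : (0 < N * M ^ d)%N by rewrite muln_gt0 N0 expn_gt0 M0.
    by move: (N * M ^ d)%N (a ^ N)%N => b K'; nia.
  rewrite expnMn; apply: (@leq_ltn_trans (K * K.+1 ^ \rank A)).
    by rewrite leq_mul2r /K leq_pexp2l ?orbT // ltnW.
  apply: (@leq_trans (K.+1 * K.+1 ^ \rank A)); last by rewrite -expnS leq_pexp2l.
  by rewrite ltn_mul2r expn_gt0 ltnSn.
have [v [v0 vK vA]] := @siegel _ _ (fun=> K) (fun=> Mo)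
  (fun i j => mon (pts (maxrankfun A i)) j) (fun _ => isT) lt_mod.
have pts_bound i j : `|mon (pts i) j| <= (M ^ d)%N%:Z.
  have [_ xM] := SP _ (mem_tnth i (in_tuple S)).
  rewrite /mon normr_prod PoszX -(eD j) mdegE -prodrXr; apply: ler_prod => l _.
  by rewrite normr_ge0 /= normrX lerXn2r ?nnegrE // -abszE lez_nat xM.
have vA0 i : \sum_j v j * mon (pts (maxrankfun A i)) j = 0.
  apply/eqP; move: (vA i); set z := \sum_j _; rewrite dvdzE /= => dz.
  rewrite -absz_eq0; apply: contraLR dz => z0; rewrite gtnNdvd ?lt0n // ltnS.
  rewrite -lez_nat abszE; apply: le_trans (ler_norm_sum _ _ _) _.
  apply: le_trans (_ : \sum_(j < N) (K * M ^ d)%N%:Z <= _); last first.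
    by rewrite sumr_const card_ord -mulr_natl natz -mulnA PoszM.
  by apply: ler_sum => j _; rewrite normrM PoszM ler_pM.
have Av : A *m (\col_j (v j)%:~R : 'cV[algC]_N) = 0.
  have /submxP[D ->] : (A <= rowsub (maxrankfun A) A)%MS by rewrite eq_maxrowsub.
  rewrite -mulmxA [X in D *m X](_ : _ = 0) ?mulmx0 //; apply/colP => i; rewrite !mxE.
  rewrite -[RHS](rmorph0 (intr : int -> algC)) -(vA0 i) rmorph_sum; apply: eq_bigr => j _.
  by rewrite !mxE rmorphM mulrC.
exists (\sum_j v j *: 'X_[e j]); split.
- have [j0 vj0] := v0; apply: contraNneq vj0 => /(congr1 (mcoeff (e j0))).
  rewrite mcoeff0 raddf_sum (bigD1 j0) //= mcoeffZ mcoeffX eqxx mulr1 big1 ?addr0 => [->//|j jj0].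
  by rewrite mcoeffZ mcoeffX (inj_eq e_inj) (negbTE jj0) mulr0.
- by rewrite rpred_sum // => j _; rewrite rpredZ // dhomogX /= eD.
- move=> x xS; have [i ->] : exists i, x = pts i.
    by have /tnthP[i ->] : x \in in_tuple S by []; exists i.
  have /colP/(_ i) := Av; rewrite !mxE => Avi; apply/eqP.
  have -> : (\sum_j v j *: 'X_[e j]).@[pts i] = \sum_j v j * mon (pts i) j.
    by rewrite raddf_sum; apply: eq_bigr => j _; rewrite /= mevalZ mevalX.
  rewrite -(intr_eq0 algC) -[X in _ == X]Avi rmorph_sum; apply/eqP/eq_bigr => j _.
  by rewrite !mxE rmorphM mulrC.
move=> m; rewrite raddf_sum /=.
have [[j ->]|H] := pselect (exists j, m = e j).
  rewrite (bigD1 j) //= mcoeffZ mcoeffX eqxx mulr1 big1 ?addr0 -?lez_nat ?abszE ?vK // => l lj.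
  by rewrite mcoeffZ mcoeffX (inj_eq e_inj) (negbTE lj) mulr0.
rewrite big1 // => j _; rewrite mcoeffZ mcoeffX; case: eqP => [ejm|]; last by rewrite mulr0.
by case: H; exists j.
Qed.

Lemma homog0_const (R : nzRingType) n (Q : {mpoly R[n]}) : Q \is 0.-homog -> Q = (Q@_0)%:MP.
Proof.
move=> hQ; apply/mpolyP => m; rewrite mcoeffC.
have [->|m0] := eqVneq m 0%MM; first by rewrite mulr1.
by rewrite mulr0 (dhomog_nemf_coeff hQ) //= mdeg_eq0.
Qed.

Lemma rdvd_same_degree (R : idomainType) n d (F G : {mpoly R[n]}) :
  F \is d.-homog -> G \is d.-homog -> G != 0 -> rdvd F G ->
  exists2 c, c != 0 & G = c *: F.
Proof.
move=> hF hG G0 [Q GE]; have F0 : F != 0 by apply: contraNneq G0 => z; rewrite GE z mulr0.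
have hQ : Q \is 0.-homog.
  by apply: (homog_quotient (p := F) (d := d)) => //; rewrite addn0 mulrC -GE.
rewrite GE (homog0_const hQ) mul_mpolyC; exists Q@_0 => //.
by apply: contraNneq G0 => Q0; rewrite GE (homog0_const hQ) Q0 mpolyC0 mul0r.
Qed.

Lemma msize_homog (R : nzRingType) n d (p : {mpoly R[n]}) :
  p != 0 -> p \is d.-homog -> msize p = d.+1.
Proof. by move=> p0 /dhomogP hp; rewrite -mlead_deg // -(hp _ (mlead_supp p0)). Qed.

Lemma irreducible_scale (F G : {mpoly algC[3]}) c : c != 0 -> F = c *: G ->
  mirreducible F -> mirreducible G.
Proof.
move=> c0 FE [F0 Fu Firr]; have uc : c%:MP_[3] \is a GRing.unit.
  by apply/unitrP; exists (c^-1)%:MP; rewrite -!mpolyCM mulVf ?mulfV // mpolyC1.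
split.
- by apply: contraNneq F0 => G0; rewrite FE G0 scaler0.
- by apply: contraNN Fu => Gu; rewrite FE -mul_mpolyC unitrM uc.
move=> A H GE; case: (Firr (c *: A) H); last by right.
  by rewrite FE GE scalerAl.
by rewrite -mul_mpolyC unitrM => /andP[_]; left.
Qed.

Lemma irreducible_homog_gt0 d (F : {mpoly algC[3]}) :
  mirreducible F -> F \is d.-homog -> (0 < d)%N.
Proof.
case: d => // -[F0 /negP Fu _] /homog0_const FE; case: Fu; rewrite FE.
have c0 : F@_0 != 0 by apply: contraNneq F0 => c0; rewrite FE c0 mpolyC0.
by apply/unitrP; exists ((F@_0)^-1)%:MP; rewrite -!mpolyCM mulVf ?mulfV // mpolyC1.
Qed.

Lemma integral_model (F : {mpoly algC[3]}) d M (S : seq {ffun 'I_3 -> int})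
    (N := 'C(d.+2, 2)) :
  mirreducible F -> F \is d.-homog -> (0 < M)%N -> uniq S ->
  {in S, forall x : {ffun 'I_3 -> int},
     [/\ Z3 x, F.@[fun i => (x i)%:~R] = 0 & forall l, (`|x l| <= M)%N]} ->
  (size S <= d * d)%N \/
  exists G : {mpoly int[3]}, [/\ exists2 c, c != 0 & F = c *: toC G, G \is d.-homog,
    {in S, forall x : {ffun 'I_3 -> int}, G.@[x] = 0} &
    forall m, (`|G@_m| <= (2 * N * M ^ d) ^ N)%N].
Proof.
move=> Firr hF M0 uS SP; have F0 : F != 0 by case: Firr.
have [|G [G0 hG SG Gb]] := integral_vanishing_form F0 hF M0 (S := S).
  by move=> x /SP[].
have [FG|FG] := EM (rdvd F (toC G)); last first.
  left; apply: (bezout (F := F) (G := toC G)) uS _; rewrite ?toC_homog //.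
  by move=> x xS; have [xZ Fx _] := SP x xS; split; rewrite // meval_toC SG.
right; exists G; split=> //; have [||c c0 GE] := rdvd_same_degree hF _ _ FG.
- by rewrite toC_homog.
- by rewrite toC_eq0.
by exists c^-1; rewrite ?invr_eq0 // GE scalerA mulVf ?scale1r.
Qed.

Lemma value_bound e (H : {mpoly int[3]}) K M (x : 'I_3 -> int) :
  H \is e.-homog -> (forall m, (`|H@_m| <= K)%N) -> (forall l, (`|x l| <= M)%N) ->
  (`|H.@[x]| <= 'C(e.+2, 2) * (K * M ^ e))%N.
Proof.
move=> hH HK xM; have [f [f_inj fD fS]] := monomial_enum e.
rewrite (meval_homog_enum _ f_inj fS hH) -lez_nat abszE.
apply: le_trans (ler_norm_sum _ _ _) _.
apply: le_trans (_ : \sum_(j < 'C(e.+2, 2)) (K * M ^ e)%N%:Z <= _); last first.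
  by rewrite sumr_const card_ord -mulr_natl natz -PoszM.
apply: ler_sum => j _; rewrite normrM PoszM ler_pM // -?abszE ?lez_nat ?HK //.
rewrite -lez_nat abszE normr_prod PoszX -(fD j) mdegE -prodrXr; apply: ler_prod => l _.
by rewrite normr_ge0 /= normrX lerXn2r ?nnegrE // -abszE lez_nat xM.
Qed.

Lemma singular_count d (G : {mpoly int[3]}) (S : seq {ffun 'I_3 -> int}) :
  mirreducible (toC G) -> G \is d.-homog -> uniq S ->
  {in S, forall x : {ffun 'I_3 -> int}, [/\ Z3 x, G.@[x] = 0 &
    forall k, (G^`M(k)).@[x] = 0]} -> (size S <= d * d)%N.
Proof.
move=> Girr hG uS SP; have d0 : (0 < d)%N.
  by apply: irreducible_homog_gt0 Girr _; rewrite toC_homog.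
have G0 : G != 0 by rewrite -toC_eq0; case: Girr.
have [k Gk] : exists k, G^`M(k) != 0.
  apply: contrapT => H; have := euler_identity hG; rewrite big1 => [/eqP|k _].
    rewrite eq_sym -scaler_nat mscalerI (negbTE G0) orbF pnatr_eq0.
    by case: (d) d0.
  by apply/eqP; rewrite mulf_eq0; apply/orP; right; apply: contra_notT H => Gk; exists k.
apply: leq_trans (_ : d * d.-1 <= _)%N; last by rewrite leq_mul2l leq_pred orbT.
apply: (bezout (F := toC G) (G := toC G^`M(k))) uS _; rewrite ?toC_homog //.
- exact: deriv_homog.
- case=> Q QE; have Gk' : toC G^`M(k) != 0 by rewrite toC_eq0.
  have tG0 : toC G != 0 by rewrite toC_eq0.
  have Q0 : Q != 0 by apply: contraNneq Gk' => Q0; rewrite QE Q0 mul0r.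
  have := congr1 (fun p : {mpoly algC[3]} => msize p) QE; rewrite msizeM //.
  rewrite (msize_homog (d := d.-1)) ?(msize_homog (d := d) tG0) ?toC_homog ?deriv_homog //.
  have : (0 < msize Q)%N by rewrite lt0n msize_poly_eq0.
  by move: (msize Q) d0 => q; lia.
by move=> x xS; have [xZ Gx dGx] := SP x xS; rewrite !meval_toC Gx dGx.
Qed.

(** * Combining several primes *)

Lemma prod_primes_dvd (ps : seq nat) (z : nat) :
  uniq ps -> {in ps, forall p, prime p /\ (p %| z)%N} -> (\prod_(p <- ps) p %| z)%N.
Proof.
elim: ps => [|p ps IH] /= ups psP; first by rewrite big_nil dvd1n.
case/andP: ups => pps ups; have [pp pz] := psP p (mem_head _ _).
have psP' : {in ps, forall q, prime q /\ (q %| z)%N}.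
  by move=> q qps; apply: psP; rewrite in_cons qps orbT.
rewrite big_cons Gauss_dvd ?pz ?IH //.
rewrite big_seq; elim/big_rec: _ => [|q a qps ca]; first exact: coprimen1.
rewrite coprimeMr ca andbT prime_coprime // dvdn_prime2 //; last by case: (psP' q qps).
by apply: contraNneq pps => ->.
Qed.

Lemma point_count (R : realType) (B : 'I_3 -> R) (F : {mpoly int[3]}) (d n pm : nat)
    (m : 'X_{1..3}) (ps : seq nat) (S : seq {ffun 'I_3 -> int}) :
  (forall l, 1 <= B l) -> mirreducible (toC F) -> F \is d.-homog ->
  m \in msupp F -> (forall m', m' \in msupp F ->
    weight B m' < weight B m \/ weight B m' = weight B m /\ (m' <= m)%O) ->
  (0 < size (aux_monomials n m))%N -> uniq ps ->
  {in ps, forall p : nat, [/\ prime p, (p <= pm)%N &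
    (size (aux_monomials n m)).+1%:R ^+ size (aux_monomials n m) *
    \prod_(e <- aux_monomials n m) weight B e <= p%:R ^+ 'C(size (aux_monomials n m), 2)]} ->
  uniq S -> {in S, forall x : {ffun 'I_3 -> int}, [/\ Z3 x, F.@[x] = 0,
    forall l, `|(x l)%:~R| <= B l &
    forall k, (`|(F^`M(k)).@[x]| < \prod_(p <- ps) p)%N]} ->
  (size S <= d * d + size ps * (9 * (pm * d) * (d * (d + n))))%N.
Proof.
move=> B1 Firr hF mF mP s0 ups psP uS SP.
pose sing (x : {ffun 'I_3 -> int}) := [forall k, (F^`M(k)).@[x] == 0].
rewrite -(count_predC sing) -!size_filter leq_add //.
  apply: singular_count Firr hF (filter_uniq _ uS) _ => x.
  rewrite mem_filter => /andP[/forallP xs /SP[xZ Fx _ _]]; split=> // k; exact/eqP.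
pose r (p : nat) (x : {ffun 'I_3 -> int}) := [exists k, ~~ (p%:Z %| (F^`M(k)).@[x])%Z].
apply: (cover_count (r := r)) => [x|p pps].
  rewrite mem_filter /= negb_forall => /andP[/existsP[k Fk] /SP[_ _ _ small]].
  apply: contrapT => H; have := small k; rewrite ltnNge dvdn_leq ?absz_gt0 //.
  apply: prod_primes_dvd => // p pps; have [pp _ _] := psP p pps; split=> //.
  rewrite -[(p %| _)%N]/(`|p%:Z| %| _)%N -dvdzE.
  by apply/negPn/negP => pk; apply: H; exists p => //; apply/existsP; exists k.
have [pp ppm big_p] := psP p pps.
rewrite -size_filter; apply: (@leq_trans (9 * (p * d) * (d * (d + n)))); last first.
  by rewrite !(leq_mul2r, leq_mul2l) ppm !orbT.
apply: prime_count B1 Firr hF pp mF mP s0 big_p _ _; first by rewrite !filter_uniq.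
move=> x; rewrite !mem_filter => /andP[/existsP xk /andP[_ /SP[xZ Fx xB _]]]; split=> //.
Qed.

Lemma points_enum (R : realType) (F : {mpoly algC[3]}) (B : 'I_3 -> R) :
  exists S : seq {ffun 'I_3 -> int}, [/\ uniq S, size S = npoints F B &
    {in S, forall x : {ffun 'I_3 -> int}, [/\ Z3 x, F.@[fun i => (x i)%:~R] = 0 &
      forall i, `|(x i)%:~R| <= B i]}].
Proof.
exists (enum_fset (fset_set (points F B))); split=> [||x xS]; first exact: fset_uniq.
  by rewrite /npoints.
by have := xS; rewrite (in_fset_set (finite_points F B)) inE.
Qed.

Lemma box_truncn (R : realType) (b : R) (z : int) :
  `|z%:~R| <= b -> (`|z| <= Num.truncn b)%N.
Proof.
move=> zb; rewrite truncn_ge_nat; first by rewrite natr_absz intr_norm.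
exact: le_trans (normr_ge0 _) zb.
Qed.

Lemma irrational_count (R : realType) d (F : {mpoly algC[3]}) (B : R) :
  mirreducible F -> F \is d.-homog -> ~ multiple_of_rational_form F ->
  (npoints F (fun=> B) <= d ^ 2)%N.
Proof.
move=> Firr hF irrF; have [S [uS <- SP]] := points_enum F (fun=> B).
have [|szS|[G [[c c0 FE] hG _ _]]] := integral_model Firr hF (ltn0Sn (Num.truncn B)) uS.
  by move=> x /SP[xZ Fx xB]; split=> // l; rewrite leqW // box_truncn.
  by rewrite -mulnn.
case: irrF; exists c, d, (map_mpoly (intr : int -> rat) G); split.
  apply/dhomogP => m; rewrite mcoeff_msupp mcoeff_map_mpoly intr_eq0 => Gm.
  by move/dhomogP: hG; apply; rewrite mcoeff_msupp.
rewrite FE; congr (_ *: _); apply/mpolyP => m.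
by rewrite mcoeff_toC !mcoeff_map_mpoly /= ratr_int.
Qed.

(** * Semistability of nonsingular curves *)

Lemma boxT_weight (R : realType) (F : {mpoly algC[3]}) (B : 'I_3 -> R) m :
  (forall l, 1 <= B l) -> m \in msupp F ->
  (forall m', m' \in msupp F -> weight B m' <= weight B m) -> boxT F B = weight B m.
Proof.
move=> B1 mF mP; apply/le_anti/andP; split; last first.
  exact: (le_bigmax_seq 0 m xpredT (weight B) mF).
rewrite /boxT big_seq; elim/big_rec: _ => [|m' t /mP m'm tm]; first exact/ltW/weight_gt0.
by rewrite ge_max tm m'm.
Qed.

Lemma boxT_exists (R : realType) (F : {mpoly algC[3]}) (B : 'I_3 -> R) :
  (forall l, 1 <= B l) -> F != 0 -> exists2 m, m \in msupp F & boxT F B = weight B m.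
Proof.
move=> B1 F0; have [m mF mP] := max_monomial B F0.
exists m => //; apply: boxT_weight => // m' /mP [/ltW //|[-> _]]; exact: lexx.
Qed.

Lemma weight_le_boxT (R : realType) (F : {mpoly algC[3]}) (B : 'I_3 -> R) m :
  m \in msupp F -> weight B m <= boxT F B.
Proof. by move=> mF; apply: (le_bigmax_seq 0 m xpredT (weight B) mF). Qed.

Lemma sort3 (R : realType) (B : 'I_3 -> R) : exists i j k : 'I_3,
  [/\ B k <= B j, B j <= B i, [&& i != j, i != k & j != k] &
      forall l, [|| l == i, l == j | l == k]].
Proof.
have ex (l : 'I_3) : [|| l == 0, l == 1 | l == 2] by case: l => [[|[|[|?]]] ?].
have [h1|h1] := leP (B 0) (B 1); have [h2|h2] := leP (B 1) (B 2);
  have [h3|h3] := leP (B 0) (B 2).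
- by exists 2, 1, 0; split=> // l; have := ex l; case/or3P => /eqP ->.
- by have := le_lt_trans (le_trans h1 h2) h3; rewrite ltxx.
- by exists 1, 2, 0; split=> //; [exact: ltW|move=> l; have := ex l; case/or3P => /eqP ->].
- by exists 1, 0, 2; split=> //; [exact: ltW|move=> l; have := ex l; case/or3P => /eqP ->].
- by exists 2, 0, 1; split=> //; [exact: ltW|move=> l; have := ex l; case/or3P => /eqP ->].
- by exists 0, 2, 1; split=> //; [exact: ltW|move=> l; have := ex l; case/or3P => /eqP ->].
- by have := le_lt_trans h3 (lt_trans h2 h1); rewrite ltxx.
- by exists 0, 1, 2; split; rewrite ?(ltW h1) ?(ltW h2).
Qed.

Lemma prod3 (R : comNzRingType) (i j k : 'I_3) (f : 'I_3 -> R) :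
  [&& i != j, i != k & j != k] -> (forall l, [|| l == i, l == j | l == k]) ->
  \prod_l f l = f i * f j * f k.
Proof.
case/and3P=> ij ik jk ex; rewrite (bigD1 i) //= (bigD1 j) 1?eq_sym //= (bigD1 k) /=.
  rewrite big1 ?mulr1 ?mulrA // => l /andP[/andP[li lj] lk].
  by have := ex l; rewrite (negbTE li) (negbTE lj) (negbTE lk).
by rewrite ![k == _]eq_sym ik jk.
Qed.

Lemma nonsingular_vertex d (F : {mpoly algC[3]}) (i : 'I_3) :
  F \is d.-homog -> nonsingular F -> exists2 m, m \in msupp F & (d.-1 <= m i)%N.
Proof.
move=> hF nsF; pose x (l : 'I_3) : algC := (l == i)%:R.
apply: contrapT => H.
have zero e (G : {mpoly algC[3]}) : G \is e.-homog -> G@_(U_(i) *+ e) = 0 -> G.@[x] = 0.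
  move=> hG Ge; rewrite mevalE big_seq big1 // => m mG.
  have [l /andP[li ml]|ml] := pickP (fun l => (l != i) && (m l != 0%N)).
    by rewrite (bigD1 l) //= /x (negbTE li) expr0n (negbTE ml) mul0r mulr0.
  suff me : m = (U_(i) *+ e)%MM by rewrite me Ge mul0r.
  have := dhomog_mf hG mG; rewrite /= mdegE (bigD1 i) //= big1 ?addn0 => [<-|l li].
    apply/mnmP => l; rewrite mulmnE mnm1E; have [->|il] := eqVneq i l; first by rewrite mul1n.
    by have := ml l; rewrite eq_sym il /= => /negbFE/eqP ->; rewrite mul0n.
  by have := ml l; rewrite li /= => /negbFE/eqP.
have noF (m : 'X_{1..3}) : (d.-1 <= m i)%N -> F@_m = 0.
  by move=> mi; apply: memN_msupp_eq0; apply: contra_notN H => mF; exists m.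
have Fx : F.@[x] = 0.
  by apply: (zero d) => //; apply: noF; rewrite mulmnE mnm1E eqxx mul1n leq_pred.
have [|k] := nsF x _ Fx; first by exists i; rewrite /x eqxx oner_eq0.
rewrite (zero d.-1) ?eqxx ?deriv_homog // mcoeff_deriv noF ?mul0rn //.
by rewrite mnmDE mulmnE mnm1E eqxx mul1n leq_addr.
Qed.

Lemma mpoly_unit_const (R : idomainType) n (p : {mpoly R[n]}) :
  p \is a GRing.unit -> p@_0 != 0 /\ p = (p@_0)%:MP.
Proof.
case/unitrP=> q [qp _]; have [p0 q0] : p != 0 /\ q != 0.
  by apply/andP; rewrite -negb_or -mulf_eq0 mulrC qp oner_eq0.
have := congr1 (fun f : {mpoly R[n]} => msize f) qp; rewrite msizeM // msize1 => s1.
have sp : msize p = 1%N.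
  have : (0 < msize p)%N by rewrite lt0n msize_poly_eq0.
  have : (0 < msize q)%N by rewrite lt0n msize_poly_eq0.
  by move: (msize p) (msize q) s1; lia.
have pE : p = (p@_0)%:MP.
  apply/mpolyP => m; rewrite mcoeffC; have [->|m0] := eqVneq m 0%MM; first by rewrite mulr1.
  rewrite mulr0; apply/memN_msupp_eq0/msize_mdeg_ge.
  by rewrite sp lt0n mdeg_eq0.
by split=> //; apply: contraNneq p0 => p0; rewrite pE p0 mpolyC0.
Qed.

Lemma irreducible_edge d (F : {mpoly algC[3]}) (k : 'I_3) : (2 <= d)%N ->
  mirreducible F -> F \is d.-homog -> exists2 m, m \in msupp F & m k = 0%N.
Proof.
move=> d2 [F0 Fu Firr] hF; apply: contrapT => H.
have mk m : m \in msupp F -> (U_(k) <= m)%MM.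
  by move=> mF; rewrite lep1mP; apply: contra_notN H => /eqP mk; exists m.
pose Q := \sum_(m <- msupp F) F@_m *: 'X_[m - U_(k)].
have FE : F = 'X_k * Q.
  rewrite {1}[F]mpolyE mulr_sumr big_seq [RHS]big_seq; apply: eq_bigr => m mF.
  by rewrite -scalerAr -mpolyXD addmC submK ?mk.
case: (Firr _ _ FE) => /mpoly_unit_const [u0 uE].
  by move: u0; rewrite mcoeffX mnm1_eq0 eqxx.
have F1 : F \is 1.-homog.
  by rewrite FE uE mulrC mul_mpolyC rpredZ // dhomogX /= mdeg1.
by have := dhomog_uniq F0 hF F1; move: d2 => /[swap] ->.
Qed.

Lemma boxT_semistable (R : realType) d (F : {mpoly algC[3]}) (B : 'I_3 -> R) :
  (2 <= d)%N -> mirreducible F -> F \is d.-homog -> nonsingular F ->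
  (forall l, 1 <= B l) -> boxV B ^+ d <= boxT F B ^+ 3.
Proof.
move=> d2 Firr hF nsF B1; have [i [j [k [kj ji ne ex]]]] := sort3 B.
have B0 l : 0 < B l by apply: lt_le_trans (B1 l).
have [m mF mi] := nonsingular_vertex i hF nsF.
have [e eF ek] := irreducible_edge k d2 Firr hF.
have sum3 (f : 'X_{1..3}) : f \in msupp F -> (f i + f j + f k = d)%N.
  move=> /(dhomog_mf hF) <-; rewrite /= mdegE.
  case/and3P: ne => ij ik jk; rewrite [RHS](bigD1 i) //= [in RHS](bigD1 j) 1?eq_sym //=.
  rewrite [in RHS](bigD1 k) /=; last by rewrite ![k == _]eq_sym ik jk.
  rewrite big1 ?addn0 ?addnA // => l /andP[/andP[li lj] lk].
  by have := ex l; rewrite (negbTE li) (negbTE lj) (negbTE lk).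
have Wm : B i ^+ d.-1 * B k <= boxT F B.
  apply: le_trans (weight_le_boxT B mF); rewrite /weight (prod3 _ ne ex).
  have [mid|mid] := eqVneq (m i) d.
    have := sum3 m mF; rewrite mid => s3.
    have -> : m j = 0%N by lia.
    have -> : m k = 0%N by lia.
    rewrite !expr0 !mulr1 -[in X in _ <= X](prednK (ltnW d2)) exprSr ler_pM2l ?exprn_gt0 //.
    exact: le_trans ji.
  have mi1 : m i = d.-1 by have := sum3 m mF; lia.
  rewrite mi1 -mulrA ler_pM2l ?exprn_gt0 //.
  have [mj|mj] := eqVneq (m j) 0%N.
    have -> : m k = 1%N by have := sum3 m mF; lia.
    by rewrite mj expr0 mul1r expr1.
  have -> : m k = 0%N by have := sum3 m mF; lia.
  have -> : m j = 1%N by have := sum3 m mF; lia.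
  by rewrite expr0 mulr1 expr1.
have We : B j ^+ d <= boxT F B.
  apply: le_trans (weight_le_boxT B eF); rewrite /weight (prod3 _ ne ex) ek expr0 mulr1.
  have -> : d = (e i + e j)%N by have := sum3 e eF; lia.
  by rewrite exprD ler_pM2r ?exprn_gt0 // lerXn2r // nnegrE ltW.
rewrite /boxV (prod3 _ ne ex) [X in _ <= X]exprSr.
(* Two factors T bound a monomial of degree at least d - 1 in the largest side, the third
   one a monomial free of the smallest side. *)
apply: le_trans (_ : (B i ^+ d.-1 * B k) ^+ 2 * B j ^+ d <= _); last first.
  have b0 : 0 <= B i ^+ d.-1 * B k by rewrite mulr_ge0 ?exprn_ge0 // ltW.
  by rewrite ler_pM ?exprn_ge0 ?(ltW (B0 _)) // lerXn2r // nnegrE (le_trans b0).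
case: (d) d2 => [|[|u]] // _ /=.
have -> : (B i * B j * B k) ^+ u.+2 = (B i ^+ u.+2 * B k ^+ 2 * B j ^+ u.+2) * B k ^+ u.
  by rewrite !exprMn -[u.+2]addn2 !exprD; ring.
have -> : (B i ^+ u.+1 * B k) ^+ 2 * B j ^+ u.+2 = (B i ^+ u.+2 * B k ^+ 2 * B j ^+ u.+2) * B i ^+ u.
  by rewrite exprMn -exprM -[u.+2]addn2 -addn1 mulnDl muln2 -addnn !exprD; ring.
have P t l : 0 < B l ^+ t by apply: exprn_gt0.
rewrite ler_pM2l; last by apply: mulr_gt0 (P _ _); apply: mulr_gt0.
by apply: lerXn2r; rewrite ?nnegrE ?(ltW (B0 _)) // (le_trans kj ji).
Qed.

(** * The main estimate *)

Lemma boxV_ge1 (R : realType) (B : 'I_3 -> R) : (forall l, 1 <= B l) -> 1 <= boxV B.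
Proof. by move=> B1; rewrite /boxV; elim/big_rec: _ => // l v _ v1; rewrite mulr_ege1. Qed.

Lemma le_boxV (R : realType) (B : 'I_3 -> R) l : (forall l, 1 <= B l) -> B l <= boxV B.
Proof.
move=> B1; rewrite /boxV (bigD1 l) //= ler_peMr ?(le_trans ler01) //.
by elim/big_rec: _ => // j v _ v1; rewrite mulr_ege1.
Qed.

Lemma deriv_value_bound (F : {mpoly int[3]}) d M k (x : 'I_3 -> int) (N := 'C(d.+2, 2)) :
  F \is d.-homog -> (forall m, (`|F@_m| <= (2 * N * M ^ d) ^ N)%N) ->
  (forall l, (`|x l| <= M)%N) ->
  (`|(F^`M(k)).@[x]| <= 'C(d.-1.+2, 2) * ((2 * N) ^ N * d) * M ^ (d * N + d.-1))%N.
Proof.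
move=> hF Fb xM.
have Fb' m : (`|F^`M(k)@_m| <= (2 * N * M ^ d) ^ N * d)%N.
  rewrite mcoeff_deriv -mulr_natr abszM natz absz_nat.
  have [->|nz] := eqVneq (F@_(m + U_(k))) 0; first by rewrite mul0n.
  have mF : (m + U_(k))%MM \in msupp F by rewrite mcoeff_msupp.
  rewrite leq_mul // -(dhomog_mf hF mF) /=.
  by rewrite mdegD mdeg1 addn1 ltnS mdegE (bigD1 k) //= leq_addr.
apply: leq_trans (value_bound (deriv_homog k hF) Fb' xM) _.
by rewrite expnMn -expnM expnD; apply: eq_leq; ring.
Qed.

Lemma scale_ge1 (R : realType) (V T : R) d : (0 < d)%N -> 1 <= V -> 1 <= T -> T <= V ^+ d ->
  1 <= V `^ d%:R^-1 * T `^ (- d%:R ^- 2).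
Proof.
move=> d0 V1 T1 TV; have V0 : 0 < V by apply: lt_le_trans V1.
have T0 : 0 < T by apply: lt_le_trans T1.
have dR : 0 < d%:R :> R by rewrite ltr0n.
rewrite powRN ler_pdivlMr ?powR_gt0 // mul1r.
apply: le_trans (_ : (V ^+ d) `^ (d%:R ^- 2) <= _).
  by apply: ge0_ler_powR; rewrite ?nnegrE ?invr_ge0 ?exprn_ge0 ?(ltW V0) ?(ltW T0).
rewrite -powR_mulrn ?(ltW V0) // -powRrM le_eqVlt; apply/orP; left; apply/eqP.
by congr (_ `^ _); field; rewrite gt_eqF.
Qed.

Lemma box_bound (R : realType) d (eps : R) : (0 < d)%N -> 0 < eps ->
  exists2 C : R, 0 < C & forall F : {mpoly algC[3]}, F \is d.-homog -> mirreducible F ->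
    forall B : 'I_3 -> R, (forall l, 1 <= B l) ->
    (npoints F B)%:R <= C * (boxT F B `^ (- d%:R ^- 2) * boxV B `^ (d%:R^-1 + eps)).
Proof.
move=> d0 eps0; have dR : 0 < d%:R :> R by rewrite ltr0n.
pose eta := eps / 2; have eta0 : 0 < eta by rewrite divr_gt0.
have de0 : 0 < d%:R^-1 + eta by rewrite addr_gt0 ?invr_gt0.
pose delta := eta / (d%:R^-1 + eta); have delta0 : 0 < delta by rewrite divr_gt0.
pose n := Num.truncn ((3 + d)%:R / eta).
have eta_n : (3 + d)%:R <= eta * n.+2%:R.
  rewrite mulrC -ler_pdivrMr //; have /andP[_ ln] := truncn_itv (divr_ge0 (ler0n R (3 + d)) (ltW eta0)).
  by apply: le_trans (ltW ln) _; rewrite ler_nat.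
pose s := ('C((d + n).+2, 2) - 'C(n.+2, 2))%N; pose N := 'C(d.+2, 2).
pose C1 := ('C(d.-1.+2, 2) * ((2 * N) ^ N * d))%N; pose E1 := (d * N + d.-1)%N.
pose c0 : R := s.+1%:R ^+ s + C1%:R.
have c0s : s.+1%:R ^+ s <= c0 by rewrite lerDl.
have c01 : 1 <= c0 by apply: le_trans c0s; rewrite exprn_ege1 // ler1n.
have c0C : C1%:R < c0 by rewrite ltrDr exprn_gt0 // ltr0n.
have c00 : 0 < c0 by apply: lt_le_trans c01.
pose r := (Num.truncn (E1%:R / eta)).+1.
have E1r : E1%:R <= eta * r%:R.
  by rewrite mulrC -ler_pdivrMr // ltW // /r; have /andP[] := truncn_itv (divr_ge0 (ler0n R E1) (ltW eta0)).
have [C2 C20 primesP] := primes_in_range r delta0.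
pose k := (r * (9 * d * (d * (d + n))))%N.
have K0 : 0 <= k%:R * (C2 * c0 `^ (1 + delta)) by rewrite !mulr_ge0 ?powR_ge0 // ltW.
exists (1 + (d * d)%:R + k%:R * (C2 * c0 `^ (1 + delta))).
  by rewrite ltr_wpDr // ltr_wpDr.
move=> F hF Firr B B1; have V1 := boxV_ge1 B1; set V := boxV B in V1 *.
have V0 : 0 < V by apply: lt_le_trans V1.
have F0 : F != 0 by case: Firr.
have [S [uS <- SP]] := points_enum F B.
pose M := Num.truncn V.
have /andP[MV VM] := truncn_itv (ltW V0); rewrite -/M in MV VM.
have M0 : (0 < M)%N by rewrite -ltnS -(ltr_nat R) (le_lt_trans V1 VM).
have SM (x : {ffun 'I_3 -> int}) : x \in S -> forall l, (`|x l| <= M)%N.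
  by move=> /SP[_ _ xB] l; apply: box_truncn; apply: le_trans (xB l) (le_boxV l B1).
pose X := V `^ d%:R^-1 * boxT F B `^ (- d%:R ^- 2).
have [m0 m0F Tm0] := boxT_exists B1 F0.
have T1 : 1 <= boxT F B by rewrite Tm0 weight_ge1.
have T0 : 0 < boxT F B by apply: lt_le_trans T1.
have TV : boxT F B <= V ^+ d.
  rewrite Tm0 /weight /V /boxV -prodrXl; apply: ler_prod => l _.
  have B0 := lt_le_trans ltr01 (B1 l).
  rewrite exprn_ge0 ?(ltW B0) //= ler_weXn2l // -(dhomog_mf hF m0F) /= mdegE (bigD1 l) //= leq_addr //.
have X1 : 1 <= X by apply: scale_ge1.
have -> : boxT F B `^ (- d%:R ^- 2) * V `^ (d%:R^-1 + eps) = X * V `^ eps.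
  rewrite powRD; last by rewrite (gt_eqF V0) implybT.
  by rewrite /X mulrCA mulrA.
have Ve1 : 1 <= V `^ eps by rewrite -(powRr0 V) ler_powR // ltW.
have XV1 : 1 <= X * V `^ eps by rewrite mulr_ege1.
have [|szS|[G [[c cn0 FE] hG SG Gb]]] := integral_model Firr hF M0 uS.
- by move=> x xS; have [xZ Fx _] := SP x xS; split=> //; apply: SM.
- apply: le_trans (_ : (d * d)%:R * (X * V `^ eps) <= _).
    by rewrite -[X in X <= _]mulr1 ler_pM // ler_nat.
  rewrite ler_pM2r; last by apply: lt_le_trans XV1.
  by move: K0; lra.
have Girr := irreducible_scale cn0 FE Firr.
have GF : msupp G =i msupp F.
  by move=> m; rewrite -msupp_toC !mcoeff_msupp FE mcoeffZ mulf_eq0 (negbTE cn0).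
have G0 : G != 0 by rewrite -toC_eq0; case: Girr.
have [m mG mP] := max_monomial B G0.
have dm : mdeg m = d by apply: (dhomog_mf hG mG).
have Tm : boxT F B = weight B m.
  apply: boxT_weight => //; first by rewrite -GF.
  by move=> m'; rewrite -GF => /mP [/ltW //|[-> _]]; exact: lexx.
have ssz : size (aux_monomials n m) = s.
  by rewrite /s -dm -size_aux_monomials addnK.
have [s1 _ _ _] := aux_exponents n d0 dm; rewrite ssz in s1.
pose Y := X * V `^ eta; pose P := c0 * Y.
have Ve : V `^ eta <= Y by rewrite ler_peMl // powR_ge0.
have Veta1 : 1 <= V `^ eta by rewrite -(powRr0 V) ler_powR // ltW.
have Y1 : 1 <= Y by apply: le_trans Ve.
have Y0 : 0 < Y by apply: lt_le_trans Y1.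
have P1 : 1 <= P by rewrite mulr_ege1.
have [ps [szps ups psP]] := primesP P P1.
pose pm := Num.truncn (C2 * P `^ (1 + delta)).
have YE : Y = V `^ (d%:R^-1 + eta) * weight B m `^ (- d%:R ^- 2).
  rewrite /Y /X Tm powRD; last by rewrite (gt_eqF V0) implybT.
  by rewrite mulrAC.
have S2pos : (0 < 'C(s, 2))%N by rewrite bin_gt0.
have count := point_count (pm := pm) (n := n) (ps := ps) B1 Girr hG mG mP _ ups _ uS.
have {count}: (size S <= d * d + size ps * (9 * (pm * d) * (d * (d + n))))%N.
  apply: count; rewrite ?ssz ?(ltnW s1) //.
    move=> p /psP[pp Pp pP]; split=> //.
      by rewrite truncn_ge_nat // mulr_ge0 ?powR_ge0 // ltW.
    apply: le_trans (_ : P ^+ 'C(s, 2) <= _); last by apply: lerXn2r; rewrite ?nnegrE ?(le_trans ler01 P1).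
    rewrite /P exprMn; apply: ler_pM; rewrite ?exprn_ge0 ?prodr_ge0 //.
    - by move=> e _; apply/ltW/weight_gt0.
    - apply: le_trans c0s _; rewrite -[X in X <= _]expr1 ler_weXn2l //.
    by have := aux_size_bound B1 d0 dm eta0 eta_n; rewrite ssz YE.
  move=> x xS; have [xZ Fx xB] := SP x xS; split=> //; first exact: SG.
  move=> l; rewrite -(ltr_nat R).
  have vb := deriv_value_bound l hG Gb (SM x xS); rewrite -/N -/C1 -/E1 in vb.
  apply: (@le_lt_trans _ _ (C1%:R * V ^+ E1)).
    apply: le_trans (_ : (C1 * M ^ E1)%N%:R <= _); first by rewrite ler_nat.
    rewrite natrM natrX ler_wpM2l //; apply: lerXn2r; rewrite ?nnegrE ?(ltW V0) //.
  apply: (@lt_le_trans _ _ (P ^+ r)).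
    rewrite /P exprMn; apply: (@lt_le_trans _ _ (c0 * V ^+ E1)).
      by rewrite ltr_pM2r ?exprn_gt0.
    apply: ler_pM; rewrite ?exprn_ge0 ?(ltW V0) ?(ltW c00) //.
      by rewrite -[X in X <= _]expr1 ler_weXn2l.
    apply: le_trans (_ : (V `^ eta) ^+ r <= _); last first.
      by apply: lerXn2r; rewrite ?nnegrE ?powR_ge0 ?(ltW Y0).
    rewrite -!powR_mulrn ?powR_ge0 ?(ltW V0) // -powRrM ler_powR //.
  rewrite -szps natr_prod; elim: (ps) psP => [|p qs IH] qsP; first by rewrite big_nil.
  rewrite big_cons /= exprS; apply: ler_pM; rewrite ?exprn_ge0 ?(le_trans ler01 P1) //.
    by have [] := qsP p (mem_head _ _).
  by apply: IH => q qq; apply: qsP; rewrite in_cons qq orbT.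
rewrite szps => szS.
have Yd : Y `^ delta <= V `^ eta.
  apply: le_trans (_ : (V `^ (d%:R^-1 + eta)) `^ delta <= _).
    apply: ge0_ler_powR; rewrite ?nnegrE ?powR_ge0 ?(ltW Y0) ?(ltW delta0) //.
    rewrite YE ler_piMr ?powR_ge0 // powRN invf_le1 ?powR_gt0 -?Tm //.
    have d20 : 0 <= d%:R ^- 2 :> R by rewrite invr_ge0 exprn_ge0.
    by have := ler_powR T1 d20; rewrite powRr0.
  by rewrite -powRrM /delta mulrC divfK ?gt_eqF.
have pmX : pm%:R <= C2 * c0 `^ (1 + delta) * (X * V `^ eps).
  have P0 : 0 <= P by apply: le_trans P1.
  have /andP[lepm _] := truncn_itv (mulr_ge0 (ltW C20) (powR_ge0 P (1 + delta))).
  apply: le_trans lepm _; rewrite -mulrA ler_pM2l // /P powRM ?(ltW c00) ?(ltW Y0) //.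
  rewrite ler_pM2l ?powR_gt0 // powRD ?powRr1 ?(ltW Y0) //; last by rewrite (gt_eqF Y0) implybT.
  have -> : X * V `^ eps = Y * V `^ eta.
    rewrite /Y -mulrA -powRD; last by rewrite (gt_eqF V0) implybT.
    by congr (_ * _ `^ _); rewrite /eta; field.
  by rewrite ler_pM2l.
apply: (@le_trans _ _ ((d * d)%:R + k%:R * pm%:R)).
  rewrite -natrM -natrD ler_nat; apply: leq_trans szS _; rewrite leq_add2l /k.
  by apply: eq_leq; ring.
rewrite !mulrDl; apply: lerD; last by rewrite -mulrA ler_wpM2l.
rewrite mul1r; apply: ler_wpDl; first exact: le_trans XV1.
by rewrite -[X in X <= _]mulr1 ler_wpM2l.
Qed.

Lemma cube_bound (R : realType) d (eps b : R) (F : {mpoly algC[3]}) :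
  (0 < d)%N -> F != 0 -> F \is d.-homog -> 1 <= b ->
  boxT F (fun=> b) `^ (- d%:R ^- 2) * boxV (fun=> b) `^ (d%:R^-1 + eps / 3) =
  b `^ (2 / d%:R + eps).
Proof.
move=> d0 F0 hF b1; have b0 : 0 < b by apply: lt_le_trans b1.
have dR : d%:R != 0 :> R by rewrite pnatr_eq0 -lt0n.
have [m mF ->] := boxT_exists (fun=> b1) F0.
rewrite /weight prodrXr -mdegE (dhomog_mf hF mF) /boxV prodr_const card_ord.
rewrite -(powR_mulrn d (ltW b0)) -(powR_mulrn 3 (ltW b0)) -!powRrM.
rewrite -powRD; last by rewrite (gt_eqF b0) implybT.
by congr (_ `^ _); field.
Qed.

Lemma semistable_bound (R : realType) d (eps V T : R) : (0 < d)%N -> 1 <= V -> 1 <= T ->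
  V ^+ d <= T ^+ 3 -> T `^ (- d%:R ^- 2) * V `^ (d%:R^-1 + eps) <= V `^ (2 / (3 * d%:R) + eps).
Proof.
move=> d0 V1 T1 VT; have V0 : 0 < V by apply: lt_le_trans V1.
have T0 : 0 < T by apply: lt_le_trans T1.
have dR : 0 < d%:R :> R by rewrite ltr0n.
have -> : V `^ (2 / (3 * d%:R) + eps) = V `^ (- (3 * d%:R)^-1) * V `^ (d%:R^-1 + eps).
  rewrite -powRD; last by rewrite (gt_eqF V0) implybT.
  by congr (_ `^ _); field; rewrite gt_eqF.
rewrite ler_pM2r ?powR_gt0 // !powRN lef_pV2 ?posrE ?powR_gt0 //.
have -> : V `^ (3 * d%:R)^-1 = (V ^+ d) `^ (3 * d%:R ^+ 2)^-1.
  rewrite -(powR_mulrn d (ltW V0)) -powRrM; congr (_ `^ _).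
  by field; rewrite gt_eqF.
have -> : T `^ (d%:R ^- 2) = (T ^+ 3) `^ (3 * d%:R ^+ 2)^-1.
  rewrite -(powR_mulrn 3 (ltW T0)) -powRrM; congr (_ `^ _).
  by field; rewrite gt_eqF.
apply: ge0_ler_powR; rewrite ?nnegrE ?exprn_ge0 ?(ltW V0) ?(ltW T0) //.
by rewrite invr_ge0 mulr_ge0 ?exprn_ge0.
Qed.

Theorem corollary1 (R : realType) (d : nat) :
  (forall eps : R, 0 < eps ->
    exists C : R, 0 < C /\
      forall F : {mpoly algC[3]}, F \is d.-homog -> mirreducible F ->
      [/\ forall B : 'I_3 -> R, (forall i, 1 <= B i) ->
            (npoints F B)%:R <=
              C * boxT F B `^ (- (d%:R ^- 2)) * boxV B `^ (d%:R^-1 + eps),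
          forall B : R, 1 <= B ->
            (npoints F (fun=> B))%:R <= C * B `^ (2 / d%:R + eps) &
          (2 <= d)%N -> nonsingular F ->
          forall B : 'I_3 -> R, (forall i, 1 <= B i) ->
            (npoints F B)%:R <= C * boxV B `^ (2 / (3 * d%:R) + eps)])
  /\
  (forall F : {mpoly algC[3]}, F \is d.-homog -> mirreducible F ->
    ~ multiple_of_rational_form F ->
    forall B : R, 1 <= B -> (npoints F (fun=> B) <= d ^ 2)%N).
Proof.
split; last by move=> F hF Firr irrF B _; apply: irrational_count.
move=> eps eps0; have [d0|d0] := posnP d.
  exists 1; split=> // F hF Firr; move: hF; rewrite d0 => hF.
  by have := irreducible_homog_gt0 Firr hF.
have [C1 C10 bound1] := box_bound d0 eps0.
have eps3 : 0 < eps / 3 by rewrite divr_gt0.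
have [C2 C20 bound2] := box_bound d0 eps3.
exists (C1 + C2); split=> [|F hF Firr]; first exact: addr_gt0.
have F0 : F != 0 by case: Firr.
split=> [B B1|b b1|d2 nsF B B1].
- rewrite -mulrA; apply: le_trans (bound1 F hF Firr B B1) _.
  by rewrite ler_wpM2r ?mulr_ge0 ?powR_ge0 // lerDl ltW.
- apply: le_trans (bound2 F hF Firr _ (fun=> b1)) _.
  by rewrite (cube_bound eps d0 F0 hF b1) ler_wpM2r ?powR_ge0 // lerDr ltW.
apply: le_trans (bound1 F hF Firr B B1) _.
have [m mF Tm] := boxT_exists B1 F0.
apply: ler_pM; rewrite ?mulr_ge0 ?powR_ge0 ?(ltW C10) ?lerDl ?(ltW C20) //.
apply: semistable_bound => //; first exact: boxV_ge1.
  by rewrite Tm weight_ge1.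
exact: boxT_semistable.
Qed.
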